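(* Let $M$ be a closed submodule of $H^2=H^2(\mathbb C^d)$ which contains a nonzero polynomial. Then every (finite or infinite) sequence $\Phi=\{\phi_1,\phi_2,\dots\}$ of multipliers of $H^2$ whose multiplication operators $M_{\phi_n}$ satisfy $$\sum_nM_{\phi_n}M_{\phi_n}^*=P_M,$$ where $P_M$ is the orthogonal projection of $H^2$ on $M$, is an inner sequence; that is, the boundary functions satisfy $$\sum_n|\tilde\phi_n(z)|^2=1$$ for $\sigma$-almost every $z\in\partial B_d$.
   Context: Let $d\ge1$, $A=\mathbb C[z_1,\dots,z_d]$, $B_d$ the open unit ball of $\mathbb C^d$, $\sigma$ the normalized surface measure on the unit sphere $\partial B_d$. $H^2=H^2(\mathbb C^d)$ is the Hilbert space completion of $A$ in the inner product for which monomials are mutually orthogonal and $\|z^\alpha\|^2=\alpha!/|\alpha|!$ (the symmetric Fock space); equivalently, the reproducing kernel Hilbert space of holomorphic functions on $B_d$ with kernel $(1-\langle z,w\rangle)^{-1}$. It is an $A$-module under multiplication; a closed submodule is a closed subspace invariant under multiplication by $z_1,\dots,z_d$. A multiplier of $H^2$ is a function $\phi$ on $B_d$ with $\phi\cdot H^2\subseteq H^2$; $M_\phi f=\phi\cdot f$ is then a bounded operator, and $\phi$ is a bounded holomorphic function with radial limits $\tilde\phi(z)=\lim_{r\uparrow1}\phi(rz)$ for $\sigma$-almost every $z\in\partial B_d$. Infinite operator sums converge in the strong operator topology. *)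

(* Defs.v *)
From HB Require Import structures.
From mathcomp Require Import all_boot all_order all_algebra.
From mathcomp Require Import complex.
From mathcomp Require Import -(notations) mpoly.
From mathcomp Require Import all_classical all_reals all_analysis.
From mathcomp Require Import measurable_realfun.

Set Implicit Arguments.
Unset Strict Implicit.
Unset Printing Implicit Defensive.

Import Order.TTheory GRing.Theory Num.Theory.
Import numFieldNormedType.Exports.

Local Open Scope classical_set_scope.
Local Open Scope ring_scope.
Local Open Scope complex_scope.

(* MathComp-Analysis puts a topology on R[i] only through the alias R[i]^o; the
   copies below make the same norm topology available on R[i] itself. *)
HB.instance Definition _ (R : realType) :=
  PseudoPointedMetric.copy R[i] R[i]^o.
HB.instance Definition _ (R : realType) := NormedModule.copy R[i] R[i]^o.

Notation normc := ComplexField.Normc.normc.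


Section prod_sf.
Context d1 d2 (T1 : measurableType d1) (T2 : measurableType d2) (R : realType).
Variables (m1 : {sigma_finite_measure set T1 -> \bar R}).
Variables (m2 : {sigma_finite_measure set T2 -> \bar R}).

(* Alias of \x carrying the sigma-finite instance, which canonical structure
   inference does not find on \x itself. *)
Definition prod_sf : set (T1 * T2) -> \bar R := (m1 \x m2)%E.

HB.instance Definition _ := Measure.on prod_sf.

Let prod_sf_sigma_finite : sigma_finite [set: (T1 * T2)%type] prod_sf.
Proof.
have /sigma_finiteP[F [TF ndF Foo]] := sigma_finiteT m1.
have /sigma_finiteP[G [TG ndG Goo]] := sigma_finiteT m2.
exists (fun n => F n `*` G n).
  rewrite -setXTT TF TG predeqE => -[x y]; split.
    move=> [/= [n _ Fnx] [k _ Gky]]; exists (maxn n k) => //; split.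
    - by move: x Fnx; exact/subsetPset/ndF/leq_maxl.
    - by move: y Gky; exact/subsetPset/ndG/leq_maxr.
  by move=> [n _ []/= ? ?]; split; exists n.
move=> k; have [? ?] := Foo k; have [? ?] := Goo k.
split; first exact: measurableX.
by rewrite /prod_sf product_measure1E// lte_mul_pinfty// ge0_fin_numE.
Qed.

HB.instance Definition _ := Measure_isSigmaFinite.Build _ _ _ prod_sf
  prod_sf_sigma_finite.

End prod_sf.

Section push_iso.
Context d1 d2 (T1 : measurableType d1) (T2 : measurableType d2) (R : realType).
Variables (mu : {sigma_finite_measure set T1 -> \bar R}).
Variables (f : T1 -> T2) (g : T2 -> T1).

(* The measurability arguments do not occur in the body: they are what makes
   the image measure below a sigma-finite measure, as needed by \x. *)
Definition push_iso of measurable_fun [set: T1] f &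
  measurable_fun [set: T2] g & cancel f g := pushforward mu f.

Hypothesis mf : measurable_fun [set: T1] f.
Hypothesis mg : measurable_fun [set: T2] g.
Hypothesis fK : cancel f g.

Let push := push_iso mf mg fK.

Let push0 : push set0 = 0%E. Proof. exact: measure0. Qed.

Let push_ge0 A : (0 <= push A)%E. Proof. exact: measure_ge0. Qed.

Let push_sigma_additive : semi_sigma_additive push.
Proof. exact: measure_semi_sigma_additive. Qed.

HB.instance Definition _ := isMeasure.Build _ _ _ push
  push0 push_ge0 push_sigma_additive.

Let push_sigma_finite : sigma_finite [set: T2] push.
Proof.
have [F UF Foo] := sigma_finiteT mu.
exists (fun n => g @^-1` F n); first by rewrite -preimage_bigcup -UF.
move=> n; have [mFn Fnoo] := Foo n; split.
  by rewrite -[X in measurable X]setTI; exact: mg.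
rewrite /push /push_iso /pushforward (_ : f @^-1` _ = F n)//.
by apply/seteqP; split=> x /=; rewrite fK.
Qed.

HB.instance Definition _ := Measure_isSigmaFinite.Build _ _ _ push
  push_sigma_finite.

End push_iso.

Section complex_measure.
Variable R : realType.

Definition ReIm (z : R[i]) : R * R := (complex.Re z, complex.Im z).
Definition of_ReIm (p : R * R) : R[i] := p.1 +i* p.2.

Lemma of_ReImK : cancel of_ReIm ReIm. Proof. by case. Qed.

(* The sigma-algebra transported from R * R along z |-> (Re z, Im z), i.e. the
   Borel sigma-algebra of the plane; n.-tuple R[i] then carries the library's
   product sigma-algebra. *)
HB.instance Definition _ :=
  Measurable.copy R[i] (g_sigma_algebra_preimageType ReIm).

Lemma measurable_ReIm : measurable_fun [set: R[i]] ReIm.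
Proof. by move=> _ B mB; exists B. Qed.

Lemma measurable_of_ReIm : measurable_fun [set: (R * R)%type] of_ReIm.
Proof.
move=> _ _ [B mB <-]; rewrite !setTI.
by rewrite (_ : _ @^-1` _ = B)//; apply/seteqP; split=> -[].
Qed.

Definition lebesgue_C : {sigma_finite_measure set R[i] -> \bar R} :=
  push_iso (prod_sf lebesgue_measure lebesgue_measure) measurable_of_ReIm measurable_ReIm of_ReImK.

Definition tcons n (p : R[i] * n.-tuple R[i]) : n.+1.-tuple R[i] :=
  [the n.+1.-tuple R[i] of p.1 :: p.2].
Definition tuncons n (t : n.+1.-tuple R[i]) : R[i] * n.-tuple R[i] :=
  (thead t, [tuple of behead t]).

Lemma tconsK n : cancel (@tcons n) (@tuncons n).
Proof.
by case=> x t; rewrite /tuncons /tcons /= theadE; congr pair; exact: val_inj.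
Qed.

Lemma measurable_tcons n : measurable_fun [set: (R[i] * n.-tuple R[i])%type] (@tcons n).
Proof. exact: measurable_cons measurable_fst measurable_snd. Qed.

Lemma measurable_tuncons n :
  measurable_fun [set: n.+1.-tuple R[i]] (@tuncons n).
Proof.
apply/measurable_fun_pair; first exact: measurable_tnth.
exact: measurable_behead.
Qed.

Fixpoint lebesgue_Cn n : {sigma_finite_measure set (n.-tuple R[i]) -> \bar R} :=
  if n is m.+1 then
    push_iso (prod_sf lebesgue_C (lebesgue_Cn m))
      (@measurable_tcons m) (@measurable_tuncons m) (@tconsK m)
  else \d_[tuple].

End complex_measure.

Section sphere.
Variables (R : realType) (d : nat).
Implicit Types z : d.-tuple R[i].

Definition tnorm z : R := Num.sqrt (\sum_(i < d) normc (tnth z i) ^+ 2).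

Definition tscale (a : R) z : d.-tuple R[i] := [tuple a%:C * tnth z i | i < d].

Definition unit_ball : set (d.-tuple R[i]) := [set z | tnorm z < 1].
Definition unit_sphere : set (d.-tuple R[i]) := [set z | tnorm z = 1].

Definition normalize z := tscale (tnorm z)^-1 z.

Lemma measurable_sqrt : measurable_fun [set: R] (@Num.sqrt R).
Proof. by apply: continuous_measurable_fun; exact: sqrt_continuous. Qed.

Lemma measurable_Re : measurable_fun [set: R[i]] (@complex.Re R).
Proof. exact: (measurableT_comp measurable_fst (@measurable_ReIm R)). Qed.

Lemma measurable_Im : measurable_fun [set: R[i]] (@complex.Im R).
Proof. exact: (measurableT_comp measurable_snd (@measurable_ReIm R)). Qed.

Lemma measurable_normc :
  measurable_fun [set: R[i]] (@ComplexField.Normc.normc R).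
Proof.
rewrite (_ : @ComplexField.Normc.normc R =
  Num.sqrt \o (fun x => complex.Re x ^+ 2 + complex.Im x ^+ 2)); last first.
  by apply/funext => -[].
apply: (measurableT_comp measurable_sqrt).
by apply: measurable_funD; apply: measurable_funX;
  [exact: measurable_Re | exact: measurable_Im].
Qed.

Lemma measurable_tnorm : measurable_fun [set: d.-tuple R[i]] tnorm.
Proof.
apply: (measurableT_comp measurable_sqrt); apply: measurable_sum => i.
apply: measurable_funX.
exact: (measurableT_comp measurable_normc (measurable_tnth i)).
Qed.

Lemma measurable_unit_ball : measurable unit_ball.
Proof.
rewrite (_ : unit_ball = tnorm @^-1` `]-oo, 1[).
  by rewrite -[X in measurable X]setTI; exact: measurable_tnorm.
by apply/seteqP; split => z /=; rewrite in_itv.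
Qed.

Lemma measurable_normalize : measurable_fun [set: d.-tuple R[i]] normalize.
Proof.
apply/measurable_fun_tnthP => i.
have mV : measurable_fun [set: d.-tuple R[i]] (fun z => (tnorm z)^-1).
  rewrite (_ : (fun z => _) = (fun x => x `^ (-1)) \o tnorm).
    exact: (measurableT_comp (measurable_powR _) measurable_tnorm).
  by apply/funext => z /=; rewrite powR_inv1// sqrtr_ge0.
rewrite (_ : _ \o _ = @of_ReIm R \o (fun z =>
    ((tnorm z)^-1 * complex.Re (tnth z i),
     (tnorm z)^-1 * complex.Im (tnth z i)))); last first.
  apply/funext => z; rewrite /= tnth_mktuple /of_ReIm.
  by case: (tnth z i) => a b /=; congr Complex; rewrite mul0r ?subr0 ?addr0.
apply: (measurableT_comp (@measurable_of_ReIm R)).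
apply/measurable_fun_pair; apply: measurable_funM => //.
- exact: (measurableT_comp measurable_Re (measurable_tnth i)).
- exact: (measurableT_comp measurable_Im (measurable_tnth i)).
Qed.

Definition ball_volume : R := fine (lebesgue_Cn R d unit_ball).

Lemma ball_volumeV_ge0 : 0 <= ball_volume^-1.
Proof. by rewrite invr_ge0 fine_ge0. Qed.

Definition uniform_ball : {measure set (d.-tuple R[i]) -> \bar R} :=
  mscale (NngNum ball_volumeV_ge0)
    (mrestr (lebesgue_Cn R d) measurable_unit_ball).

(* Normalized surface measure as the cone measure: the mass of A is the
   proportion of the volume of the unit ball that lies on the rays through A.
   It is a measure on C^d concentrated on the sphere; the ray of the origin is
   negligible when 0 < d. *)
Definition surface_measure : set (d.-tuple R[i]) -> \bar R :=
  pushforward uniform_ball normalize.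

Let surface_measure0 : surface_measure set0 = 0%E.
Proof. by rewrite /surface_measure /pushforward preimage_set0 measure0. Qed.

Let surface_measure_ge0 A : (0 <= surface_measure A)%E.
Proof. exact: (measure_ge0 uniform_ball). Qed.

Let surface_measure_sigma_additive : semi_sigma_additive surface_measure.
Proof.
have mN := measurable_normalize; exact: measure_semi_sigma_additive.
Qed.

HB.instance Definition _ := isMeasure.Build _ _ _ surface_measure
  surface_measure0 surface_measure_ge0 surface_measure_sigma_additive.

End sphere.

Section drury_arveson.
Variables (R : realType) (d : nat).

(* An element of the symmetric Fock space is represented by the family of its
   Taylor coefficients, so that the completion of C[z_1, ..., z_d] becomes a
   weighted l^2 space over the multi-indices. *)
Notation coef := (multinom d -> R[i]).
Implicit Types (f g h : coef) (M : set coef) (T : coef -> coef).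
Implicit Types (z : d.-tuple R[i]) (phi : d.-tuple R[i] -> R[i]).

Definition monomial_sqnorm (m : multinom d) : R :=
  (\prod_(i < d) (m i)`!)%:R / (mdeg m)`!%:R.

Definition sqnorm f : \bar R :=
  (\esum_(m in [set: multinom d])
     (monomial_sqnorm m * normc (f m) ^+ 2)%:E)%E.

Definition H2 : set coef := [set f | (sqnorm f < +oo)%E].

(* bmultinom d n is the finite type of multi-indices of degree < n; on H2, and
   at points of the ball below, the series converge absolutely. *)
Definition inner f g : R[i] :=
  limn (fun n => \sum_(m : bmultinom d n)
    (monomial_sqnorm m)%:C * f m * (g m)^*).

Definition fun_of f z : R[i] :=
  limn (fun n => \sum_(m : bmultinom d n)
    f m * \prod_(i < d) tnth z i ^+ m i).

(* g represents the pointwise product of phi and f on the unit ball. *)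
Definition is_product phi f g : Prop :=
  H2 g /\ forall z, unit_ball z -> fun_of g z = phi z * fun_of f z.

Definition multiplier phi : Prop :=
  forall f, H2 f -> exists g, is_product phi f g.

(* In the next three definitions xget selects the unique element with the
   stated property; 0 is a dummy value. *)
Definition mult_op phi : coef -> coef :=
  fun f => xget 0 [set g | is_product phi f g].

Definition adjoint T : coef -> coef :=
  fun g => xget 0
    [set h | H2 h /\ forall f, H2 f -> inner (T f) g = inner f h].

Definition orth_proj M : coef -> coef :=
  fun f => xget 0 [set g | M g /\ forall h, M h -> inner (f - g) h = 0].

Definition closed_submodule M : Prop :=
  [/\ M `<=` H2,
      M 0,
      forall (a : R[i]) f g, M f -> M g -> M (a *: f + g),
      forall (i : 'I_d) f, M f -> M (mult_op (fun z => tnth z i) f) &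
      forall f, H2 f ->
        (forall e : R, 0 < e -> exists2 g, M g & (sqnorm (f - g)%R < e%:E)%E) ->
        M f].

Definition coef_of_poly (p : mpoly d R[i]) : coef := fun m => mcoeff m p.

(* Finite and infinite sequences are handled together: the terms of a sequence
   are those of index n with in_range len n, where len is its length (None for
   an infinite sequence). *)
Definition in_range (len : option nat) (n : nat) : bool :=
  if len is Some N then (n < N)%N else true.

Definition strong_sum (len : option nat) (T_ : nat -> coef -> coef) T : Prop :=
  forall f, H2 f ->
    sqnorm (\sum_(0 <= n < N | in_range len n) T_ n f - T f) @[N --> \oo]
      --> 0%E.

Definition radial phi z : R -> R[i] := fun r => phi (tscale r z).

Definition boundary phi z : R[i] := lim (radial phi z r @[r --> 1^'-]).

Definition inner_sequence (len : option nat)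
    (phi_ : nat -> d.-tuple R[i] -> R[i]) : Prop :=
  {ae @surface_measure R d, forall z, unit_sphere z ->
    (forall n, in_range len n -> cvg (radial (phi_ n) z r @[r --> 1^'-])) /\
    (\sum_(0 <= n <oo | in_range len n)
       (normc (boundary (phi_ n) z) ^+ 2)%:E = 1)%E}.

End drury_arveson.

(* Main.v *)
Require Import Defs.
From mathcomp Require Import all_boot all_order all_algebra.
From mathcomp Require Import complex.
From mathcomp Require Import -(notations) mpoly.
From mathcomp Require Import all_classical all_reals all_analysis.
From mathcomp Require Import measurable_realfun.
From mathcomp Require Import ring lra zify.

(** Write k_a(z) = 1 / (1 - <z, a>) for the reproducing kernel and
    h_a = k_a - P_M k_a for its component orthogonal to M.  Since the adjoint of
    multiplication by phi maps k_b to conj(phi(b)) k_b, applying the operator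
    identity to k_b and evaluating at a gives
      sum_n phi_n(a) conj(phi_n(b)) = 1 - (1 - <a, b>) <h_b, h_a>     (gram_cvg).
    So everything is governed by the size of h_a as a approaches the sphere.

    Two estimates are played against each other.  Fix z on the sphere and put
    E(r) = r |h_(rz)|^2.  The identity above, combined with
    2 Re <h, h'> <= |h|^2 + |h'|^2, yields
      sum_n |phi_n(rz) - phi_n(sz)|^2 <= (s - r) (E(s) - E(r))   for r <= s < 1
    (sum_nsqB_le); in particular E is nondecreasing.  On the other hand a
    polynomial p in M forces h_a to be small where p does not vanish: p k_a lies
    in M, so |p(a)|^2 |h_a|^2 <= |p k_a - p(a) k_a|^2, and the kernel is almost an
    eigenvector of the coordinate multiplications,
      sum_i |z_i k_a - a_i k_a|^2 = 1 + (d - 1) sum_n |a|^(2n) / (n + 1),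
    which grows more slowly than 1 / (1 - |a|) (kern_rest_le, eigen_defect_le).
    The bound E(1 - 4^-j) = O(2^j) is all that is used.  It makes the square
    distance between the values at 1 - 4^-j and at any later radius
    O(2^-j), so r |-> (phi_n(rz))_n converges in l^2 at every z of the sphere with
    p(z) <> 0, and the square norm of its limit is
    lim (1 - (1 - r^2) |h_(rz)|^2) = 1 (radial_limits_at).  Convergence in l^2 is what allows the limit and the
    infinite sum to be exchanged.

    It remains that the zeros of p on the sphere are negligible.  The surface
    measure is the cone measure, so this is a statement about the cone over these
    zeros.  The function |w|^(2N) p(w/|w|) p(-w/|w|) is a polynomial in the
    real and imaginary parts of w, because only even powers of |w| survive; it
    vanishes on the cone and is not identically zero, hence its zero set is
    null by Fubini (surface_null). *)

Set Implicit Arguments.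
Unset Strict Implicit.
Unset Printing Implicit Defensive.

Import Order.TTheory GRing.Theory Num.Theory.
Import numFieldNormedType.Exports.

Local Open Scope classical_set_scope.
Local Open Scope ring_scope.
Local Open Scope complex_scope.

(** * Complex numbers and complex limits *)

Section complex_sequences.
Local Open Scope ring_scope.
Variable R : realType.
Implicit Types (z w : R[i]) (x y : R).

(** The square modulus, without the square root that hides in [normc]: identities
    between values of [nsq] are ring identities in the real and imaginary parts. *)
Definition nsq z : R := complex.Re z ^+ 2 + complex.Im z ^+ 2.

Lemma complex_eqP z w :
  complex.Re z = complex.Re w -> complex.Im z = complex.Im w -> z = w.
Proof. by case: z w => a b [c e] /= -> ->. Qed.

Lemma nsq_ge0 z : 0 <= nsq z. Proof. by rewrite addr_ge0 ?sqr_ge0. Qed.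

Lemma nsqE z : normc z ^+ 2 = nsq z.
Proof. by case: z => a b; rewrite /nsq /= sqr_sqrtr// addr_ge0 ?sqr_ge0. Qed.

Lemma normc_nsq z : normc z = Num.sqrt (nsq z).
Proof. by case: z. Qed.

Lemma normc_ge0 z : 0 <= normc z.
Proof. by rewrite normc_nsq sqrtr_ge0. Qed.

Lemma normr_normc z : `|z| = (normc z)%:C.
Proof. by case: z. Qed.

Lemma nsqM z w : nsq (z * w) = nsq z * nsq w.
Proof. by case: z w => a b [c d]; rewrite /nsq /=; ring. Qed.

Lemma nsqN z : nsq (- z) = nsq z.
Proof. by case: z => a b; rewrite /nsq /=; ring. Qed.

(** Unfolds the abstract conjugation, so that case analysis on [z] computes it. *)
Lemma conjE z : z^* = conjc z. Proof. by []. Qed.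

Lemma nsqJ z : nsq z^* = nsq z.
Proof. rewrite conjE; case: z => a b; rewrite /nsq /=; ring. Qed.

Lemma nsqC x : nsq x%:C = x ^+ 2.
Proof. by rewrite /nsq /=; ring. Qed.

Lemma nsq0 : nsq 0 = 0. Proof. by rewrite /nsq /=; ring. Qed.

Lemma nsq_eq0 z : nsq z = 0 -> z = 0.
Proof.
case: z => a b /eqP; rewrite /nsq /= paddr_eq0 ?sqr_ge0//.
by rewrite !sqrf_eq0 => /andP[/eqP-> /eqP->].
Qed.

Lemma mulcJ z : z * z^* = (nsq z)%:C.
Proof. by rewrite conjE; case: z => a b; rewrite /nsq; apply: complex_eqP => /=; ring. Qed.

Lemma conjD z w : (z + w)^* = z^* + w^*. Proof. by rewrite rmorphD. Qed.

Lemma conjN z : (- z)^* = - z^*. Proof. by rewrite rmorphN. Qed.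

Lemma conjM z w : (z * w)^* = z^* * w^*. Proof. by rewrite rmorphM. Qed.

Lemma conjK z : z^*^* = z. Proof. exact: conjcK. Qed.

Lemma conjR x : (x%:C)^* = x%:C. Proof. exact: conjc_real. Qed.

Lemma Re_mulJ x z : complex.Re (x%:C * z^* * z) = x * nsq z.
Proof. by rewrite -mulrA [_ * z]mulrC mulcJ /=; ring. Qed.

Lemma nsqD_young (t : R) z w : 0 < t ->
  nsq (z + w) <= (1 + t) * nsq z + (1 + t^-1) * nsq w.
Proof.
move=> t0; case: z w => a a' [b b']; rewrite /nsq /= -subr_ge0.
rewrite (_ : _ - _ = t^-1 * ((t * a - b) ^+ 2 + (t * a' - b') ^+ 2)); last first.
  by field; rewrite gt_eqF.
by rewrite mulr_ge0 ?invr_ge0 ?(ltW t0)// addr_ge0 ?sqr_ge0.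
Qed.

Lemma nsqD_le z w : nsq (z + w) <= 2 * nsq z + 2 * nsq w.
Proof. by have := nsqD_young z w ltr01; rewrite invr1. Qed.

Lemma normcM_le z w : normc (z * w) <= (nsq z + nsq w) / 2.
Proof.
rewrite ComplexField.Normc.normcM -!nsqE.
have := sqr_ge0 (normc z - normc w); lra.
Qed.

Lemma normr_Re z : `|complex.Re z| <= normc z.
Proof.
by rewrite normc_nsq -[leLHS]sqrtr_sqr ler_sqrt ?nsq_ge0// lerDl sqr_ge0.
Qed.

Lemma normr_Im z : `|complex.Im z| <= normc z.
Proof.
by rewrite normc_nsq -[leLHS]sqrtr_sqr ler_sqrt ?nsq_ge0// lerDr sqr_ge0.
Qed.

Lemma normc_leD z : normc z <= `|complex.Re z| + `|complex.Im z|.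
Proof.
case: z => a b /=; rewrite -[leRHS]ger0_norm ?addr_ge0// -sqrtr_sqr.
rewrite ler_sqrt ?sqr_ge0// -(real_normK (num_real a)) -(real_normK (num_real b)).
by have := normr_ge0 a; have := normr_ge0 b; nra.
Qed.

Lemma normc_sum (I : Type) (r : seq I) (P : pred I) (F : I -> R[i]) :
  normc (\sum_(i <- r | P i) F i) <= \sum_(i <- r | P i) normc (F i).
Proof.
rewrite -lecR -normr_normc; apply: le_trans (ler_norm_sum _ _ _) _.
by rewrite rmorph_sum /=; apply: ler_sum => i _; rewrite normr_normc.
Qed.

Lemma cvgc_unique (z : nat -> R[i]) (l k : R[i]) :
  z n @[n --> \oo] --> l -> z n @[n --> \oo] --> k -> l = k.
Proof. by move=> zl zk; rewrite -(cvg_lim _ zl)// (cvg_lim _ zk). Qed.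

Section filter.
Local Open Scope ring_scope.
Context (T : Type) (F : set_system T) {FF : Filter F}.

(** Moves convergence from complex-valued radii to real ones. *)
Lemma cvgcP (f : T -> R[i]) (l : R[i]) :
  f x @[x --> F] --> l <-> normc (f x - l) @[x --> F] --> (0 : R).
Proof.
split => [/cvgrPdist_lt fl|/cvgrPdist_lt fl].
  apply/cvgrPdist_lt => e e0.
  have e0' : 0 < e%:C by rewrite ltcR.
  apply: filterS (fl _ e0') => t.
  by rewrite distrC normr_normc ltcR sub0r normrN ger0_norm// normc_ge0.
apply/cvgrPdist_lt => -[e e'] /[dup] e0.
rewrite ltcE /= => /andP[/eqP e'0 e0'].
apply: filterS (fl _ e0') => t.
rewrite sub0r normrN ger0_norm ?normc_ge0// distrC normr_normc.
by rewrite ltcE /= -e'0 eqxx.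
Qed.

Lemma cvg_complexP (f : T -> R[i]) (l : R[i]) :
  f x @[x --> F] --> l <->
  complex.Re (f x) @[x --> F] --> complex.Re l /\
  complex.Im (f x) @[x --> F] --> complex.Im l.
Proof.
have ReB (z w : R[i]) : complex.Re (z - w) = complex.Re z - complex.Re w.
  by case: z w => ? ? [].
have ImB (z w : R[i]) : complex.Im (z - w) = complex.Im z - complex.Im w.
  by case: z w => ? ? [].
split => [/cvgcP fl|[fr fi]].
  split; apply/subr_cvg0; apply/norm_cvg0P; apply: squeeze_cvgr fl;
    [| exact: cvg_cst | | exact: cvg_cst]; apply: nearW => t; rewrite normr_ge0/=.
    by rewrite -ReB normr_Re.
  by rewrite -ImB normr_Im.
apply/cvgcP.
have : `|complex.Re (f x) - complex.Re l| + `|complex.Im (f x) - complex.Im l|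
    @[x --> F] --> (0 : R).
  rewrite -[X in _ --> X]addr0; apply: cvgD; apply/norm_cvg0P/subr_cvg0 => //.
apply: squeeze_cvgr; last exact: cvg_cst.
by apply: nearW => t; rewrite normc_ge0 -ReB -ImB normc_leD.
Qed.

End filter.

Lemma sqr_cauchy_cvg (x : nat -> R) (e : nat -> R) :
  e n @[n --> \oo] --> (0 : R) ->
  (forall n k, (n <= k)%N -> (x k - x n) ^+ 2 <= e n) -> cvgn x.
Proof.
move=> e0 xe; apply: cauchy_cvg; apply/cauchy_exP => /= r r0.
have /e0[N _ /(_ N (leqnn N))] : nbhs (0 : R) (ball (0 : R) ((r / 2) ^+ 2)).
  by apply: nbhsx_ballx; rewrite exprn_gt0// divr_gt0.
rewrite /ball /= sub0r normrN => eN.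
exists (x N); exists N => // k /= /(xe _) xk.
rewrite /ball /= distrC.
suff : `|x k - x N| < r / 2 by move/lt_trans; apply; rewrite ltr_pdivrMr//; lra.
rewrite -(@ltr_pXn2r _ 2)// ?nnegrE ?divr_ge0// ?(ltW r0)//.
rewrite real_normK ?num_real//; apply: le_lt_trans xk _.
exact: le_lt_trans (ler_norm _) eN.
Qed.

(** Completeness of the complex plane, applied to both coordinates; a bound on
    squares is what the Hilbert space estimates below provide. *)
Lemma nsq_cauchy_cvg (z : nat -> R[i]) (e : nat -> R) :
  e n @[n --> \oo] --> (0 : R) ->
  (forall n k, (n <= k)%N -> nsq (z k - z n) <= e n) -> cvgn z.
Proof.
move=> e0 ze.
have cr : cvgn (fun n => complex.Re (z n)).
  apply: (sqr_cauchy_cvg e0) => n k nk; apply: le_trans (ze _ _ nk).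
  by case: (z n) (z k) => a b [c d]; rewrite /nsq /= lerDl sqr_ge0.
have ci : cvgn (fun n => complex.Im (z n)).
  apply: (sqr_cauchy_cvg e0) => n k nk; apply: le_trans (ze _ _ nk).
  by case: (z n) (z k) => a b [c d]; rewrite /nsq /= lerDr sqr_ge0.
apply/cvg_ex; exists (limn (fun n => complex.Re (z n)) +i* limn (fun n => complex.Im (z n))).
by apply/cvg_complexP.
Qed.

End complex_sequences.

Local Notation up i m := (mnm_add m (mnm1 i)).
Local Notation down i m := (mnm_sub m (mnm1 i)).

(** * Sums over multi-indices *)

Section power_series.
Local Open Scope ring_scope.
Variables (R : realType) (d : nat).
Implicit Types (u v : multinom d -> R) (f g : multinom d -> R[i]) (i : 'I_d).

(** Sums over the multi-indices of degree < n.  The same definition serves real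
    and complex coefficients and families of coefficient functions. *)
Definition psum (V : nmodType) (u : multinom d -> V) n :=
  \sum_(m : bmultinom d n) u m.

Lemma psum_widen (V : nmodType) (u : multinom d -> V) n k : (n <= k)%N ->
  psum u n = \sum_(m : bmultinom d k | (mdeg m < n)%N) u m.
Proof.
move=> nk; rewrite /psum.
pose h (m : bmultinom d n) : bmultinom d k :=
  BMultinom (leq_trans (bmdeg m) nk).
rewrite (reindex_omap h (fun m => insub (val m))) /=; last first.
  move=> m mn; rewrite insubT /=; congr Some; exact: val_inj.
apply: eq_bigl => m; rewrite bmdeg /= insubT ?bmdeg// => p /=.
by apply/esym/eqP; congr Some; exact: val_inj.
Qed.

Lemma psumD (V : nmodType) (u v : multinom d -> V) n :
  psum (fun m => u m + v m) n = psum u n + psum v n.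
Proof. exact: big_split. Qed.

Lemma psumZ (K : pzRingType) (a : K) (u : multinom d -> K) n :
  psum (fun m => a * u m) n = a * psum u n.
Proof. by rewrite /psum mulr_sumr. Qed.

Lemma psum_nondecreasing u : (forall m, 0 <= u m) ->
  {homo psum u : n k / (n <= k)%N >-> n <= k}.
Proof.
move=> u0 n k nk; rewrite (psum_widen _ nk) /psum.
rewrite [leRHS](bigID (fun m : bmultinom d k => (mdeg m < n)%N)) /=.
by rewrite lerDl sumr_ge0.
Qed.

Lemma le_psum u v n : (forall m, u m <= v m) -> psum u n <= psum v n.
Proof. by move=> uv; apply: ler_sum => m _. Qed.

Lemma psum_ge0 u n : (forall m, 0 <= u m) -> 0 <= psum u n.
Proof. by move=> u0; apply: sumr_ge0 => m _. Qed.

Lemma cvg_psum u C : (forall m, 0 <= u m) -> (forall n, psum u n <= C) ->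
  cvgn (psum u).
Proof.
move=> u0 uC; apply: nondecreasing_is_cvgn; first exact: psum_nondecreasing.
by exists C => _ [n _ <-].
Qed.

Lemma psum_le_lim u C n : (forall m, 0 <= u m) -> (forall n, psum u n <= C) ->
  psum u n <= limn (psum u).
Proof.
by move=> u0 uC; apply: nondecreasing_cvgn_le; [exact: psum_nondecreasing|exact: cvg_psum uC].
Qed.

Lemma term_le_psum u m n : (forall m, 0 <= u m) -> (mdeg m < n)%N ->
  u m <= psum u n.
Proof.
move=> u0 mn; rewrite /psum (bigD1 (BMultinom mn)) //= lerDl.
exact: sumr_ge0.
Qed.

Definition abssum f := exists C : R, forall n, psum (fun m => normc (f m)) n <= C.

Lemma abssum_le u f C : (forall m, normc (f m) <= u m) ->
  (forall n, psum u n <= C) -> abssum f.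
Proof. by move=> fu uC; exists C => n; apply: le_trans (uC n); exact: le_psum. Qed.

(** The standard splitting of an absolutely summable family as a difference of
    two nonnegative ones. *)
Lemma cvg_psum_abs u C : (forall n, psum (fun m => `|u m|) n <= C) ->
  cvgn (psum u).
Proof.
move=> uC.
have -> : psum u = (fun n => psum (fun m => u m + `|u m|) n - psum (fun m => `|u m|) n).
  by apply/funext => n; rewrite psumD addrK.
apply: is_cvgB; last by apply: cvg_psum uC.
apply: (@cvg_psum _ (C + C)) => [m|n].
  by have := ler_norm (- u m); rewrite normrN; lra.
by rewrite psumD lerD//; apply: le_trans (uC n); apply: le_psum => m; exact: ler_norm.
Qed.

Lemma cvg_psumc f : abssum f -> cvgn (psum f).
Proof.
move=> [C fC].
have cr : cvgn (psum (fun m => complex.Re (f m))).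
  apply: (@cvg_psum_abs _ C) => n; apply: le_trans (fC n).
  by apply: le_psum => m; exact: normr_Re.
have ci : cvgn (psum (fun m => complex.Im (f m))).
  apply: (@cvg_psum_abs _ C) => n; apply: le_trans (fC n).
  by apply: le_psum => m; exact: normr_Im.
apply/cvg_ex; exists (limn (psum (fun m => complex.Re (f m))) +i*
  limn (psum (fun m => complex.Im (f m)))).
apply/cvg_complexP; split => /=.
  rewrite (_ : (fun _ => _) = psum (fun m => complex.Re (f m)))//.
  by apply/funext => n; rewrite /psum raddf_sum.
rewrite (_ : (fun _ => _) = psum (fun m => complex.Im (f m)))//.
by apply/funext => n; rewrite /psum raddf_sum.
Qed.

(** The effect on Taylor coefficients of multiplication by the i-th coordinate. *)
Definition shift (V : nmodType) i (u : multinom d -> V) : multinom d -> V :=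
  fun m => if m i == 0%N then 0 else u (down i m).

Lemma downK i (m : multinom d) : m i != 0%N -> up i (down i m) = m.
Proof. by move=> mi; rewrite submK// lep1mP. Qed.

Lemma upE i (m : multinom d) : up i m i = (m i).+1.
Proof. by rewrite mnmDE mnm1E eqxx addn1. Qed.

Lemma shift_up (V : nmodType) i (u : multinom d -> V) m :
  shift i u (up i m) = u m.
Proof. by rewrite /shift upE /= addmK. Qed.

(** Reindexing by [m |-> m + e_i]: a shift costs exactly one degree. *)
Lemma psum_shift (V : nmodType) i (u : multinom d -> V) n :
  psum (shift i u) n.+1 = psum u n.
Proof.
rewrite /psum /shift.
rewrite (bigID (fun m : bmultinom d n.+1 => (m : multinom d) i == 0%N)) /=.
rewrite big1 ?add0r; last by move=> m /= ->.
have hP (m : bmultinom d n) : (mdeg (up i m) < n.+1)%N.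
  by rewrite mdegD mdeg1 addn1 ltnS bmdeg.
rewrite (reindex_omap (fun m => BMultinom (hP m))
  (fun m : bmultinom d n.+1 => insub (down i m))) /=.
  apply: eq_big => [m|m _]; last by rewrite upE /= addmK.
  rewrite upE /= addmK insubT ?bmdeg// => p /=.
  by apply/eqP; congr Some; exact: val_inj.
move=> m mi; rewrite insubT.
  rewrite -ltnS -[X in (X < _)%N]addn1 -[X in (_ + X < _)%N](mdeg1 i) -mdegD.
  by rewrite downK// bmdeg.
by move=> p /=; congr Some; apply: val_inj; rewrite /= downK.
Qed.

End power_series.

(** * The weights of the symmetric Fock space *)

Section weights.
Local Open Scope ring_scope.
Variable d : nat.
Implicit Types (m : multinom d) (i : 'I_d).

(** The multinomial coefficient |m|!/m!, inverse of the weight; it is taken in an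
    arbitrary numeric field because it is needed over the reals and over the complex numbers. *)
Definition invw (F : numFieldType) m : F :=
  (mdeg m)`!%:R / (\prod_(i < d) (m i)`!)%:R.

Definition monom (F : pzRingType) (x : 'I_d -> F) m : F := \prod_(i < d) x i ^+ m i.

Lemma monom_up (F : comNzRingType) (x : 'I_d -> F) i m :
  monom x (up i m) = x i * monom x m.
Proof.
rewrite /monom (bigD1 i) //= [in RHS](bigD1 i) //= upE exprS -!mulrA.
congr (_ * (_ * _)); apply: eq_bigr => j ji.
by rewrite mnmDE mnm1E eq_sym (negbTE ji) addn0.
Qed.

Lemma prod_fact_up i m :
  (\prod_(j < d) (up i m j)`! = (m i).+1 * \prod_(j < d) (m j)`!)%N.
Proof.
rewrite (bigD1 i) //= [in RHS](bigD1 i) //= upE factS -!mulnA.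
congr (_ * (_ * _))%N; apply: eq_bigr => j ji.
by rewrite mnmDE mnm1E eq_sym (negbTE ji) addn0.
Qed.

Lemma prod_fact_neq0 (F : numFieldType) m :
  ((\prod_(i < d) (m i)`!)%:R : F) != 0.
Proof.
by rewrite pnatr_eq0 -lt0n; apply: prodn_gt0 => i; exact: fact_gt0.
Qed.

Lemma fact_neq0 (F : numFieldType) n : (n`!%:R : F) != 0.
Proof. by rewrite pnatr_eq0 -lt0n fact_gt0. Qed.

Lemma invw_gt0 (F : numFieldType) m : 0 < invw F m.
Proof.
by rewrite lt0r mulf_neq0 ?invr_eq0 ?prod_fact_neq0 ?fact_neq0// mulr_ge0 ?invr_ge0.
Qed.

Lemma shift_invw (F : numFieldType) i m :
  shift i (invw F) m = invw F m * (m i)%:R / (mdeg m)%:R.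
Proof.
rewrite /shift; case: eqP => [->|/eqP mi]; first by rewrite mulr0 mul0r.
rewrite -[in RHS](downK mi) /invw prod_fact_up upE mdegD mdeg1 addn1 factS !natrM.
have := prod_fact_neq0 F (down i m); have := fact_neq0 F (mdeg (down i m)).
have : ((down i m i).+1%:R : F) != 0 by rewrite pnatr_eq0.
have : ((mdeg (down i m)).+1%:R : F) != 0 by rewrite pnatr_eq0.
by move=> ? ? ? ?; field; apply/and3P.
Qed.

(** Pascal's rule for multinomial coefficients. *)
Lemma sum_shift_invw (F : numFieldType) m : m != mnm0 ->
  \sum_(i < d) shift i (invw F) m = invw F m.
Proof.
move=> m0; under eq_bigr do rewrite shift_invw.
rewrite -mulr_suml -mulr_sumr -natr_sum -mdegE mulfK// pnatr_eq0.
by rewrite mdeg_eq0.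
Qed.

(** The multinomial theorem in all degrees < n at once, weighted by a function of
    the degree.  Pascal's rule turns the sum of order n + 1 for [g] into g(0) plus
    (x_1 + ... + x_d) times the sum of order n for g(. + 1). *)
Lemma multinomial_psum (F : numFieldType) (g : nat -> F) (x : 'I_d -> F) n :
  psum (fun m => g (mdeg m) * (invw F m * monom x m)) n =
  \sum_(k < n) g k * (\sum_(i < d) x i) ^+ k.
Proof.
elim: n g => [|n IH] g.
  by rewrite big_ord0 /psum big1// => m; have := bmdeg m.
pose v m := g (mdeg m).+1 * (invw F m * monom x m).
rewrite (_ : (fun m => _) = fun m => (if m == mnm0 then g 0%N else 0) +
    \sum_(i < d) x i * shift i v m); last first.
  apply/funext => m; case: eqP => [->|/eqP m0].
    rewrite mdeg0 big1 ?addr0; last by move=> i _; rewrite /shift mnm0E mulr0.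
    rewrite /invw mdeg0 /monom !big1 ?divr1 ?mulr1// => i _; by rewrite mnm0E.
  rewrite add0r -[in LHS](sum_shift_invw F m0) mulr_suml mulr_sumr.
  apply: eq_bigr => i _; rewrite /shift; case: eqP => [_|/eqP mi].
    by rewrite mul0r !mulr0.
  rewrite -{1 3}(downK mi) monom_up mdegD mdeg1 addn1 /v; ring.
rewrite psumD big_ord_recl expr0 mulr1; congr (_ + _).
  rewrite /psum (bigD1 (BMultinom (bm0_proof d n))) //= eqxx big1 ?addr0// => m.
  by rewrite -val_eqE /= => /negbTE ->.
under [RHS]eq_bigr do rewrite exprS mulrCA /=.
rewrite -mulr_sumr -(IH (fun k => g k.+1)) /psum exchange_big /= mulr_suml; apply: eq_bigr => i _.
by rewrite -mulr_sumr; congr (_ * _); exact: psum_shift.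
Qed.

Variable R : realType.
Local Notation w := (@monomial_sqnorm R d).

Lemma invwE m : (w m)^-1 = invw R m.
Proof. by rewrite /monomial_sqnorm /invw invf_div. Qed.

Lemma invwC m : (invw R m)%:C = invw R[i] m.
Proof. by rewrite /invw rmorphM fmorphV /= !rmorph_nat. Qed.

Lemma w_gt0 m : 0 < w m.
Proof. by rewrite -invr_gt0 invwE invw_gt0. Qed.

Lemma w_up i m : w (up i m) = w m * (m i).+1%:R / (mdeg m).+1%:R.
Proof.
have := shift_invw R i (up i m); rewrite shift_up upE mdegD mdeg1 addn1 -!invwE.
have := w_gt0 m; have := w_gt0 (up i m).
have : ((m i).+1%:R : R) != 0 by rewrite pnatr_eq0.
have : ((mdeg m).+1%:R : R) != 0 by rewrite pnatr_eq0.
move=> h1 h2 /lt0r_neq0 h3 /lt0r_neq0 h4 h.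
apply: (mulfI (invr_neq0 h4)); apply: (mulfI (invr_neq0 h3)).
rewrite [X in _ * (X * _)]h; field.
by rewrite nat1r h1 h3 h4.
Qed.

Lemma w_up_le i m : w (up i m) <= w m.
Proof.
rewrite w_up -mulrA ler_piMr ?(ltW (w_gt0 m))// ler_pdivrMr// mul1r ler_nat ltnS.
by rewrite mdegE (bigD1 i) //= leq_addr.
Qed.

(** The operator sum_i M_i^* M_i, where M_i is multiplication by the i-th
    coordinate, acts on homogeneous polynomials of degree n as (n + d)/(n + 1). *)
Lemma sum_w_up m : \sum_(i < d) w (up i m) = w m * (mdeg m + d)%:R / (mdeg m).+1%:R.
Proof.
under eq_bigr do rewrite w_up.
rewrite -mulr_suml -mulr_sumr -natr_sum; congr (_ * _%:R * _).
under eq_bigr do rewrite -addn1.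
by rewrite big_split /= -mdegE sum_nat_const card_ord muln1.
Qed.

End weights.

(** * The Hilbert space structure *)

Section hilbert.
Local Open Scope ring_scope.
Variables (R : realType) (d : nat).
Implicit Types (u : multinom d -> R) (f g h : multinom d -> R[i]) (a : R[i]).
Local Notation w := (@monomial_sqnorm R d).

Lemma mdeg_lt_seq n :
  [set m : multinom d | (mdeg m < n)%N] = [set` [seq val m | m : bmultinom d n]].
Proof.
apply/seteqP; split => m /=; last by move=> /mapP[[k kn] _ ->].
by move=> mn; apply/mapP; exists (BMultinom mn); rewrite ?mem_enum.
Qed.

Lemma psum_fsum u n :
  (psum u n)%:E = (\sum_(m \in [set m : multinom d | (mdeg m < n)%N]) (u m)%:E)%E.
Proof.
have ur : uniq [seq val m | m : bmultinom d n].
  by rewrite map_inj_uniq ?enum_uniq//; exact: val_inj.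
by rewrite mdeg_lt_seq -fsbig_seq// big_image /= sumEFin.
Qed.

Lemma finite_mdeg n : finite_set [set m : multinom d | (mdeg m < n)%N].
Proof. by rewrite mdeg_lt_seq; exact: finite_seq. Qed.

Lemma psum_le_esum u n : ((psum u n)%:E <= \esum_(m in setT) (u m)%:E)%E.
Proof.
apply: esum_ge; exists [set m : multinom d | (mdeg m < n)%N].
  by split => //; exact: finite_mdeg.
by rewrite -psum_fsum.
Qed.

(** Unordered sums of nonnegative families are limits over the degree, since every
    finite set of multi-indices has bounded degree. *)
Lemma esum_psum u C : (forall m, 0 <= u m) -> (forall n, psum u n <= C) ->
  (\esum_(m in setT) (u m)%:E)%E = (limn (psum u))%:E.
Proof.
move=> u0 uC; apply/eqP; rewrite eq_le; apply/andP; split.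
  apply: ge_ereal_sup => _ [X [finX _] <-].
  have [n Xn] : exists n, forall m, X m -> (mdeg m < n)%N.
    move/finite_seqP: finX => [s ->].
    exists (\max_(m <- s) mdeg m).+1 => m ms; rewrite ltnS.
    exact: (@leq_bigmax_seq _ _ xpredT (@mdeg d) m).
  apply: (@le_trans _ _ (psum u n)%:E); last by rewrite lee_fin; exact: psum_le_lim uC.
  rewrite psum_fsum; apply: lee_fsum_nneg_subset => //.
  - exact: finite_mdeg.
  - by move=> m; rewrite !inE; exact: Xn.
  - by move=> m _; rewrite lee_fin.
have cu := cvg_psum u0 uC.
rewrite -EFin_lim//; apply: lime_le.
  by apply/cvg_ex; exists (limn (psum u))%:E; apply: cvg_EFin => //; exact: nearW.
by apply: nearW => n; exact: psum_le_esum.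
Qed.

Definition wsq f m := w m * nsq (f m).

(** The real-valued square norm; meaningful on [H2], where it is the value of
    [sqnorm]. *)
Definition nrm2 f : R := limn (psum (wsq f)).

Lemma wsq_ge0 f m : 0 <= wsq f m.
Proof. by rewrite mulr_ge0 ?nsq_ge0// ltW// w_gt0. Qed.

Lemma sqnorm_wsq f : sqnorm f = (\esum_(m in setT) (wsq f m)%:E)%E.
Proof. by apply: eq_esum => m _; rewrite nsqE. Qed.

Lemma H2P f : H2 f <-> exists C, forall n, psum (wsq f) n <= C.
Proof.
rewrite /H2 /= sqnorm_wsq; split => [fin|[C fC]].
  exists (fine (\esum_(m in setT) (wsq f m)%:E)) => n.
  rewrite -lee_fin fineK ?psum_le_esum// ge0_fin_numE//.
  by apply: esum_ge0 => m _; rewrite lee_fin wsq_ge0.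
by rewrite (esum_psum (wsq_ge0 f) fC) ltry.
Qed.

Lemma sqnormE f : H2 f -> sqnorm f = (nrm2 f)%:E.
Proof.
by move=> /H2P[C fC]; rewrite sqnorm_wsq (esum_psum (wsq_ge0 f) fC).
Qed.

Lemma cvg_nrm2 f : H2 f -> cvgn (psum (wsq f)).
Proof. by move=> /H2P[C fC]; apply: cvg_psum fC; exact: wsq_ge0. Qed.

Lemma psum_nrm2 f n : H2 f -> psum (wsq f) n <= nrm2 f.
Proof. by move=> /H2P[C fC]; apply: psum_le_lim fC; exact: wsq_ge0. Qed.

Lemma H2_le f C : (forall n, psum (wsq f) n <= C) -> H2 f.
Proof. by move=> fC; apply/H2P; exists C. Qed.

Lemma nrm2_le f C : (forall n, psum (wsq f) n <= C) -> nrm2 f <= C.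
Proof.
move=> fC; apply: limr_le; first by apply: cvg_nrm2; exact: H2_le fC.
exact: nearW.
Qed.

Lemma nrm2_ge0 f : H2 f -> 0 <= nrm2 f.
Proof.
move=> fH; apply: le_trans (psum_nrm2 0 fH).
by apply: psum_ge0 => m; exact: wsq_ge0.
Qed.

Lemma wsqZ a f m : wsq (a *: f) m = nsq a * wsq f m.
Proof. by rewrite /wsq -[(a *: f) m]/(a * f m) nsqM mulrCA. Qed.

Lemma wsqD_le f g m : wsq (f + g) m <= 2 * wsq f m + 2 * wsq g m.
Proof.
rewrite /wsq -[(f + g) m]/(f m + g m).
have := nsqD_le (f m) (g m); have := w_gt0 R m; nra.
Qed.

Lemma H2D f g : H2 f -> H2 g -> H2 (f + g).
Proof.
move=> fH gH; apply: (@H2_le _ (2 * nrm2 f + 2 * nrm2 g)) => n.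
apply: le_trans (le_psum _ (wsqD_le f g)) _.
by rewrite psumD !psumZ lerD// ler_pM2l// psum_nrm2.
Qed.

Lemma nrm2D_le f g : H2 f -> H2 g -> nrm2 (f + g) <= 2 * nrm2 f + 2 * nrm2 g.
Proof.
move=> fH gH; apply: nrm2_le => n.
apply: le_trans (le_psum _ (wsqD_le f g)) _.
by rewrite psumD !psumZ lerD// ler_pM2l// psum_nrm2.
Qed.

Lemma psum_wsqZ a f n : psum (wsq (a *: f)) n = nsq a * psum (wsq f) n.
Proof. by rewrite -psumZ; congr psum; apply/funext => m; exact: wsqZ. Qed.

Lemma H2Z a f : H2 f -> H2 (a *: f).
Proof.
move=> fH; apply: (@H2_le _ (nsq a * nrm2 f)) => n.
by rewrite psum_wsqZ ler_wpM2l ?nsq_ge0// psum_nrm2.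
Qed.

Lemma nrm2Z a f : H2 f -> nrm2 (a *: f) = nsq a * nrm2 f.
Proof.
move=> fH; apply: cvg_lim => //.
rewrite (_ : psum _ = (fun n => nsq a * psum (wsq f) n)).
  by apply: cvgM; [exact: cvg_cst|exact: cvg_nrm2].
by apply/funext => n; exact: psum_wsqZ.
Qed.

Lemma H20 : H2 (0 : multinom d -> R[i]).
Proof.
apply: (@H2_le _ 0) => n; rewrite /psum big1// => m _.
by rewrite /wsq nsq0 mulr0.
Qed.

Lemma H2N f : H2 f -> H2 (- f).
Proof. by move=> fH; rewrite -scaleN1r; exact: H2Z. Qed.

Lemma H2B f g : H2 f -> H2 g -> H2 (f - g).
Proof. by move=> fH gH; apply: H2D => //; exact: H2N. Qed.

Lemma nrm2N f : nrm2 (- f) = nrm2 f.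
Proof.
congr (limn (psum _)); apply/funext => m.
by rewrite /wsq -[(- f) m]/(- f m) nsqN.
Qed.

Lemma H2_sum (I : Type) (r : seq I) (P : pred I) (F : I -> multinom d -> R[i]) :
  (forall i, P i -> H2 (F i)) -> H2 (\sum_(i <- r | P i) F i).
Proof. by move=> FH; elim/big_ind : _ => //; [exact: H20|exact: H2D]. Qed.

Definition inner_term f g m : R[i] := (w m)%:C * f m * (g m)^*.

Lemma innerE f g : inner f g = limn (psum (inner_term f g)). Proof. by []. Qed.

Lemma abssum_inner f g : H2 f -> H2 g -> abssum (inner_term f g).
Proof.
move=> fH gH.
apply: (@abssum_le _ _ (fun m => 2^-1 * (wsq f m + wsq g m)) _ (2^-1 * (nrm2 f + nrm2 g))).
  move=> m; rewrite /inner_term -mulrA ComplexField.Normc.normcM.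
  rewrite -[(w m)%:C]/((w m) +i* 0) /= expr0n addr0 sqrtr_sqr ger0_norm; last first.
    by rewrite ltW// w_gt0.
  apply: le_trans (ler_wpM2l _ (normcM_le _ _)) _; first by rewrite ltW// w_gt0.
  by rewrite nsqJ /wsq -mulrDr mulrA mulrC.
by move=> n; rewrite psumZ psumD ler_pM2l ?invr_gt0// lerD// psum_nrm2.
Qed.

Lemma cvg_inner f g : H2 f -> H2 g -> psum (inner_term f g) n @[n --> \oo] --> inner f g.
Proof. by move=> fH gH; exact: cvg_psumc (abssum_inner fH gH). Qed.

Lemma innerDl f g h : H2 f -> H2 g -> H2 h -> inner (f + g) h = inner f h + inner g h.
Proof.
move=> fH gH hH; rewrite [LHS]innerE; apply: cvg_lim => //.
rewrite (_ : psum _ = fun n => psum (inner_term f h) n + psum (inner_term g h) n).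
  by apply: cvgD; exact: cvg_inner.
apply/funext => n; rewrite -psumD; congr psum; apply/funext => m.
by rewrite /inner_term -[(f + g) m]/(f m + g m); ring.
Qed.

Lemma innerZl a f h : H2 f -> H2 h -> inner (a *: f) h = a * inner f h.
Proof.
move=> fH hH; rewrite [LHS]innerE; apply: cvg_lim => //.
rewrite (_ : psum _ = fun n => a * psum (inner_term f h) n).
  by apply: cvgM; [exact: cvg_cst|exact: cvg_inner].
apply/funext => n; rewrite -psumZ; congr psum; apply/funext => m.
by rewrite /inner_term -[(a *: f) m]/(a * f m); ring.
Qed.

Lemma cvg_conjc (F : nat -> R[i]) (l : R[i]) :
  F n @[n --> \oo] --> l -> (F n)^* @[n --> \oo] --> l^*.
Proof.
move=> /cvg_complexP[Fr Fi]; apply/cvg_complexP; split.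
  rewrite (_ : (fun _ => _) = (fun n => complex.Re (F n))); last first.
    by apply/funext => n; case: (F n).
  by case: l Fr Fi.
rewrite (_ : (fun _ => _) = (fun n => - complex.Im (F n))); last first.
  by apply/funext => n; case: (F n).
by case: l Fr Fi => a b Fr Fi /=; exact: cvgN.
Qed.

Lemma innerC f g : H2 f -> H2 g -> inner g f = (inner f g)^*.
Proof.
move=> fH gH; rewrite [LHS]innerE; apply: cvg_lim => //.
rewrite (_ : psum _ = fun n => (psum (inner_term f g) n)^*).
  by apply: cvg_conjc; exact: cvg_inner.
apply/funext => n; rewrite /psum rmorph_sum /=; apply: eq_bigr => m _.
by rewrite /inner_term !conjM conjK conjR; ring.
Qed.

Lemma inner_nrm2 f : H2 f -> inner f f = (nrm2 f)%:C.
Proof.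
move=> fH; rewrite innerE; apply: cvg_lim => //.
rewrite (_ : psum _ = fun n => (psum (wsq f) n)%:C).
  by apply/cvg_complexP; split => /=; [exact: cvg_nrm2|exact: cvg_cst].
apply/funext => n; rewrite /psum rmorph_sum /=; apply: eq_bigr => m _.
by rewrite /inner_term -mulrA mulcJ -rmorphM.
Qed.

Lemma innerNl f h : H2 f -> H2 h -> inner (- f) h = - inner f h.
Proof. by move=> fH hH; rewrite -scaleN1r innerZl// mulN1r. Qed.

Lemma innerBl f g h : H2 f -> H2 g -> H2 h -> inner (f - g) h = inner f h - inner g h.
Proof. by move=> fH gH hH; rewrite innerDl ?innerNl//; exact: H2N. Qed.

Lemma innerDr f g h : H2 f -> H2 g -> H2 h -> inner h (f + g) = inner h f + inner h g.
Proof.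
by move=> fH gH hH; rewrite (innerC (H2D fH gH) hH) innerDl// conjD -!innerC.
Qed.

Lemma innerZr a f h : H2 f -> H2 h -> inner h (a *: f) = a^* * inner h f.
Proof.
by move=> fH hH; rewrite (innerC (H2Z a fH) hH) innerZl// conjM -innerC.
Qed.

Lemma innerBr f g h : H2 f -> H2 g -> H2 h -> inner h (f - g) = inner h f - inner h g.
Proof.
move=> fH gH hH; rewrite (innerDr fH (H2N gH) hH) -(scaleN1r g) innerZr//.
by rewrite conjN rmorph1 mulN1r.
Qed.

Lemma nrm2D f g : H2 f -> H2 g ->
  nrm2 (f + g) = nrm2 f + nrm2 g + 2 * complex.Re (inner f g).
Proof.
move=> fH gH; apply: complexI; rewrite -(inner_nrm2 (H2D fH gH)).
rewrite (innerDl fH gH (H2D fH gH)) !innerDr// !inner_nrm2// (innerC fH gH) conjE.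
by case: (inner f g) => x y; apply: complex_eqP => /=; ring.
Qed.

Lemma nrm2B f g : H2 f -> H2 g ->
  nrm2 (f - g) = nrm2 f + nrm2 g - 2 * complex.Re (inner f g).
Proof.
move=> fH gH; rewrite (nrm2D fH (H2N gH)) nrm2N.
rewrite -(scaleN1r g) innerZr// conjN rmorph1 mulN1r.
by case: (inner f g) => x y /=; ring.
Qed.

Lemma nrm2_parallelogram f g : H2 f -> H2 g ->
  nrm2 (f + g) + nrm2 (f - g) = 2 * nrm2 f + 2 * nrm2 g.
Proof. by move=> fH gH; rewrite nrm2D ?nrm2B//; ring. Qed.

(** The usual argument with [f - t <f, g> g]; when [nrm2 g] vanishes a large [t]
    is taken instead of 1/[nrm2 g]. *)
Lemma cauchy_schwarz f g : H2 f -> H2 g -> nsq (inner f g) <= nrm2 f * nrm2 g.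
Proof.
move=> fH gH.
set c := inner f g.
have key (t : R) : 0 <= nrm2 f + t ^+ 2 * nsq c * nrm2 g - 2 * t * nsq c.
  have gH' : H2 ((t%:C * c) *: g) by exact: H2Z.
  have := nrm2_ge0 (H2B fH gH'); rewrite nrm2B// nrm2Z// nsqM nsqC innerZr//.
  rewrite -/c conjM conjR Re_mulJ.
  by move=> /le_trans; apply; lra.
have c0 := nsq_ge0 c; have f0 := nrm2_ge0 fH; have g0 := nrm2_ge0 gH.
have [g1|g1] := eqVneq (nrm2 g) 0.
  rewrite g1 mulr0; have [//|c1] := eqVneq (nsq c) 0; first by move=> ->.
  have := key ((nrm2 f + 1) / (2 * nsq c)); rewrite g1 mulr0 addr0.
  rewrite (_ : 2 * _ * _ = nrm2 f + 1); last by field.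
  lra.
have := key (nrm2 g)^-1.
rewrite (_ : _ - _ = (nrm2 f * nrm2 g - nsq c) / nrm2 g); last by field.
by rewrite pmulr_lge0 ?invr_gt0 ?lt0r ?g1// subr_ge0.
Qed.

End hilbert.

(** * Reproducing kernels and coordinate shifts *)

Section kernel.
Local Open Scope ring_scope.
Variables (R : realType) (d : nat).
Implicit Types (f g h : multinom d -> R[i]) (z : d.-tuple R[i]) (i : 'I_d).
Implicit Types m : multinom d.
Local Notation w := (@monomial_sqnorm R d).

(** Taylor coefficients of w |-> 1 / (1 - <w, z>). *)
Definition kern z m : R[i] := invw R[i] m * (monom (tnth z) m)^*.

Definition sqabs z : R := \sum_(i < d) nsq (tnth z i).

Lemma unit_ballP z : unit_ball z <-> sqabs z < 1.
Proof.
rewrite /unit_ball /tnorm /=; under eq_bigr do rewrite nsqE.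
rewrite -/(sqabs z); split => [|z1]; last by rewrite -sqrtr1 ltr_sqrt.
by rewrite -{1}sqrtr1 ltr_sqrt.
Qed.

Lemma sqabs_ge0 z : 0 <= sqabs z.
Proof. by apply: sumr_ge0 => i _; exact: nsq_ge0. Qed.

Lemma invw_wC m : (w m)%:C * invw R[i] m = 1.
Proof. by rewrite -invwC -rmorphM -invwE divff ?rmorph1// lt0r_neq0 ?w_gt0. Qed.

Lemma conj_invw m : (invw R[i] m)^* = invw R[i] m :> R[i].
Proof. by rewrite -invwC conjR. Qed.

Lemma inner_kern_term f z : inner_term f (kern z) = fun m => f m * monom (tnth z) m.
Proof.
apply/funext => m; rewrite /inner_term /kern conjM conjK conj_invw.
by rewrite mulrACA invw_wC mul1r.
Qed.

(** The two series agree term by term, so the reproducing property holds for every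
    family of coefficients, convergent or not. *)
Lemma inner_kern f z : inner f (kern z) = fun_of f z.
Proof. by rewrite innerE inner_kern_term. Qed.

Lemma nsq_monom z m : nsq (monom (tnth z) m) = monom (fun i => nsq (tnth z i)) m.
Proof.
rewrite /monom; elim/big_rec2 : _ => [|i x y _ <-]; first by rewrite /nsq /=; ring.
rewrite nsqM; congr (_ * _).
elim: (m i) => [|k IH]; first by rewrite !expr0 /nsq /=; ring.
by rewrite !exprS nsqM IH.
Qed.

Lemma wsq_kern z m : wsq (kern z) m = invw R m * monom (fun i => nsq (tnth z i)) m.
Proof.
rewrite /wsq /kern nsqM nsqJ nsq_monom -invwC nsqC -invwE.
by field; rewrite lt0r_neq0 ?w_gt0.
Qed.

(** By the multinomial theorem the degree-k part of the kernel has square norm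
    |z|^(2k); the factor [g] is used for the weight 1/(k + 1). *)
Lemma psum_wsq_kern (g : nat -> R) z n :
  psum (fun m => g (mdeg m) * wsq (kern z) m) n = \sum_(k < n) g k * sqabs z ^+ k.
Proof.
rewrite -multinomial_psum; congr psum; apply/funext => m.
by rewrite wsq_kern.
Qed.

Lemma geometric_le (x : R) n : 0 <= x < 1 -> \sum_(k < n) x ^+ k <= (1 - x)^-1.
Proof.
move=> /andP[x0 x1]; have x1' : 0 < 1 - x by rewrite subr_gt0.
rewrite -[leRHS]mul1r ler_pdivlMr// mulrC -opprB mulNr -subrX1 opprB.
by rewrite lerBlDr lerDl exprn_ge0.
Qed.

Lemma sqabs_ball z : unit_ball z -> 0 <= sqabs z < 1.
Proof. by move=> /unit_ballP z1; rewrite sqabs_ge0. Qed.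

Lemma H2_kern z : unit_ball z -> H2 (kern z).
Proof.
move=> /sqabs_ball z1; apply: (@H2_le _ _ _ (1 - sqabs z)^-1) => n.
have := psum_wsq_kern (fun=> 1) z n.
rewrite (_ : (fun m => _) = wsq (kern z)); last by apply/funext => m; rewrite mul1r.
move=> ->; under eq_bigr do rewrite mul1r.
exact: geometric_le.
Qed.

Definition hdot z1 z2 : R[i] := \sum_(i < d) tnth z1 i * (tnth z2 i)^*.

(** The geometric series: its partial sums satisfy T_(n+1) = 1 + <z1, z2> T_n, and
    the limit inherits the equation. *)
Lemma inner_kern_kern z1 z2 : unit_ball z1 -> unit_ball z2 ->
  (1 - hdot z1 z2) * inner (kern z2) (kern z1) = 1.
Proof.
move=> b1 b2; set T := psum (inner_term (kern z2) (kern z1)).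
have TE n : T n = \sum_(k < n) hdot z1 z2 ^+ k.
  have := multinomial_psum (fun=> 1) (fun i => tnth z1 i * (tnth z2 i)^*) n.
  under [RHS]eq_bigr do rewrite mul1r.
  move=> <-; congr psum; rewrite inner_kern_term; apply/funext => m.
  rewrite mul1r /kern -mulrA; congr (_ * _); rewrite mulrC /monom rmorph_prod.
  by rewrite -big_split; apply: eq_bigr => i _; rewrite exprMn rmorphXn.
have TS n : T n.+1 = 1 + hdot z1 z2 * T n.
  rewrite !TE big_ord_recl expr0 mulr_sumr; congr (_ + _).
  by apply: eq_bigr => k _; rewrite exprS.
have Tl : T n @[n --> \oo] --> inner (kern z2) (kern z1).
  by apply: cvg_inner; exact: H2_kern.
have Tl1 : T n.+1 @[n --> \oo] --> inner (kern z2) (kern z1).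
  by rewrite -(cvg_shiftS T) in Tl.
have Tl2 : T n.+1 @[n --> \oo] --> 1 + hdot z1 z2 * inner (kern z2) (kern z1).
  under eq_fun do rewrite TS.
  exact: cvgD (cvg_cst _) (cvgM (cvg_cst _) Tl).
have e := cvgc_unique Tl1 Tl2.
by rewrite mulrBl mul1r {1}e addrK.
Qed.

Lemma nrm2_kern z : unit_ball z -> nrm2 (kern z) = (1 - sqabs z)^-1.
Proof.
move=> b; have x1 := sqabs_ball b; have := inner_kern_kern b b.
rewrite (inner_nrm2 (H2_kern b)) /hdot.
under eq_bigr do rewrite mulcJ.
rewrite -rmorph_sum -(rmorph1 (real_complex R)) -rmorphB -rmorphM => /complexI.
rewrite -/(sqabs z) => e.
have nz : 1 - sqabs z != 0 by rewrite subr_eq0 eq_sym lt_eqF//; case/andP: x1.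
by apply: (mulfI nz); rewrite e divff.
Qed.

Lemma shiftE (V : nmodType) i (u : multinom d -> V) m :
  shift i u m = if m i == 0%N then 0 else u (down i m).
Proof. by []. Qed.

Lemma wsq_shift f i : wsq (shift i f) = shift i (fun m => w (up i m) * nsq (f m)).
Proof.
apply/funext => m; rewrite /wsq !shiftE; case: eqP => [_|/eqP mi].
  by rewrite nsq0 mulr0.
by rewrite downK.
Qed.

Lemma psum_wsq_shift f i n :
  psum (wsq (shift i f)) n.+1 = psum (fun m => w (up i m) * nsq (f m)) n.
Proof. by rewrite wsq_shift psum_shift. Qed.

Lemma psum_wsq_shift_le f i n : psum (wsq (shift i f)) n <= psum (wsq f) n.
Proof.
case: n => [|n]; first by rewrite /psum !big1// => m; have := bmdeg m.
rewrite psum_wsq_shift; apply: le_trans (psum_nondecreasing _ (leqnSn n)); last exact: wsq_ge0.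
by apply: le_psum => m; rewrite ler_wpM2r ?nsq_ge0// w_up_le.
Qed.

Lemma H2_shift f i : H2 f -> H2 (shift i f).
Proof.
move=> fH; apply: (@H2_le _ _ _ (nrm2 f)) => n.
exact: le_trans (psum_wsq_shift_le _ _ _) (psum_nrm2 _ fH).
Qed.

Lemma nrm2_shift f i : H2 f -> nrm2 (shift i f) <= nrm2 f.
Proof.
move=> fH; apply: nrm2_le => n.
exact: le_trans (psum_wsq_shift_le _ _ _) (psum_nrm2 _ fH).
Qed.

Lemma cvg_fun_of f z : H2 f -> unit_ball z ->
  psum (fun m => f m * monom (tnth z) m) n @[n --> \oo] --> fun_of f z.
Proof.
move=> fH zb; rewrite -inner_kern -inner_kern_term.
by apply: cvg_inner => //; exact: H2_kern.
Qed.

Lemma fun_of_shift f i z : H2 f -> unit_ball z ->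
  fun_of (shift i f) z = tnth z i * fun_of f z.
Proof.
move=> fH zb.
have := cvg_fun_of (H2_shift i fH) zb; rewrite -cvg_shiftS => c1.
have c2 : psum (fun m => shift i f m * monom (tnth z) m) n.+1 @[n --> \oo] -->
    tnth z i * fun_of f z.
  rewrite (_ : (fun n => _) = fun n => tnth z i * psum (fun m => f m * monom (tnth z) m) n).
    by apply: cvgM; [exact: cvg_cst|exact: cvg_fun_of].
  apply/funext => n; rewrite -psumZ -[RHS](psum_shift i); congr psum.
  apply/funext => m; rewrite !shiftE; case: eqP => [_|/eqP mi]; first by rewrite mul0r.
  by rewrite -{2}(downK mi) monom_up mulrCA.
exact: cvgc_unique c1 c2.
Qed.

End kernel.

(** * The identity theorem on the ball *)

Section identity.
Local Open Scope ring_scope.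
Variables (R : realType) (d : nat).
Implicit Types (f g h : multinom d -> R[i]) (z : d.-tuple R[i]) (i : 'I_d).
Implicit Types m : multinom d.

Lemma digits_inj (B e : nat) (a b : 'I_e -> nat) :
  (forall i : 'I_e, a i < B)%N -> (forall i : 'I_e, b i < B)%N ->
  (\sum_(i < e) a i * B ^ i = \sum_(i < e) b i * B ^ i)%N -> a =1 b.
Proof.
elim: e a b => [|e IH] a b aB bB; first by move=> _ [].
rewrite !big_ord_recl expn0 !muln1.
have E (c : 'I_e.+1 -> nat) : (\sum_(i < e) c (lift ord0 i) * B ^ bump 0 i =
    (\sum_(i < e) c (lift ord0 i) * B ^ i) * B)%N.
  rewrite big_distrl /=; apply: eq_bigr => i _.
  by rewrite /bump /= add1n expnSr mulnA.
rewrite !E => ab.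
have B0 : (0 < B)%N by exact: leq_ltn_trans (aB ord0).
have ab0 : a ord0 = b ord0.
  have := congr1 (modn^~ B) ab; rewrite /= ![(_ + _ * B)%N]addnC !modnMDl.
  by rewrite !modn_small.
move: ab; rewrite ab0 => /addnI/eqP; rewrite eqn_pmul2r// => /eqP/IH H i.
have [j ->|->] := unliftP ord0 i; last by [].
by apply: H => k.
Qed.

(** Some linear weight with positive coefficients attains its minimum on the support
    of [f] at a single index.  Adding a large constant to the powers of n + 1 makes the
    degree dominate, and among the indices of the minimal degree n the remaining
    part is an expansion in base n + 1. *)
Lemma separating_weight f : f <> 0 ->
  exists2 a, f a != 0 & exists2 c : 'I_d -> nat, (forall i, (0 < c i)%N) &
    forall m, f m != 0 -> m != a ->
      (\sum_(i < d) a i * c i < \sum_(i < d) m i * c i)%N.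
Proof.
move=> f0.
have [m1 fm1] : exists m, f m != 0.
  apply: contrapT => nf; apply: f0; apply/funext => m.
  by apply/eqP/negPn/negP => fm; apply: nf; exists m.
have exn : exists n, `[<exists2 m, f m != 0 & mdeg m = n>].
  by exists (mdeg m1); apply/asboolP; exists m1.
case: (ex_minnP exn) => n /asboolP[b fb bn] nmin.
pose c (i : 'I_d) := (n * n.+1 ^ d + 1 + n.+1 ^ i)%N.
pose W m := (\sum_(i < d) m i * c i)%N.
have WE m : W m = ((n * n.+1 ^ d + 1) * mdeg m + \sum_(i < d) m i * n.+1 ^ i)%N.
  rewrite /W; under eq_bigr do rewrite mulnDr.
  by rewrite big_split /= -big_distrl /= -mdegE mulnC.
have exW : exists k, `[<exists2 m, f m != 0 & W m = k>].
  by exists (W m1); apply/asboolP; exists m1.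
case: (ex_minnP exW) => k /asboolP[a fa ak] kmin.
have degW m : f m != 0 -> W m = k -> mdeg m = n.
  move=> fm mk; apply/eqP; rewrite eqn_leq nmin ?andbT; last first.
    by apply/asboolP; exists m.
  have : (W m <= W b)%N by rewrite mk; apply: kmin; apply/asboolP; exists b.
  rewrite !WE bn => le.
  have bsum : (\sum_(i < d) b i * n.+1 ^ i <= n * n.+1 ^ d)%N.
    rewrite -bn mdegE big_distrl /=; apply: leq_sum => i _.
    by rewrite leq_mul2l leq_pexp2l ?orbT// ltnW.
  rewrite leqNgt; apply/negP => mn.
  have : ((n * n.+1 ^ d + 1) * n.+1 <= (n * n.+1 ^ d + 1) * n + n * n.+1 ^ d)%N.
    apply: leq_trans (leq_trans le _); last by rewrite leq_add2l.
    by apply: leq_trans (leq_addr _ _); rewrite leq_mul2l mn orbT.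
  by rewrite mulnSr leq_add2l addn1 ltnn.
exists a => //; exists c => [i|m fm ma]; first by rewrite /c !addn_gt0 orbT.
rewrite -/(W a) -/(W m) ltn_neqAle ak kmin ?andbT; last by apply/asboolP; exists m.
apply: contra ma => /eqP km; apply/eqP/mnmP; apply: (@digits_inj n.+1).
- by move=> i; rewrite ltnS -(degW m fm (esym km)) mdegE (bigD1 i)//= leq_addr.
- by move=> i; rewrite ltnS -(degW a fa ak) mdegE (bigD1 i)//= leq_addr.
have : W m = W a by rewrite ak -km.
rewrite !WE (degW m fm (esym km)) (degW a fa ak).
by move/addnI.
Qed.

Lemma normc_realM (x : R) (z : R[i]) : 0 <= x -> normc (z * x%:C) = normc z * x.
Proof.
move=> x0; rewrite ComplexField.Normc.normcM; congr (_ * _).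
by rewrite /= expr0n addr0 sqrtr_sqr ger0_norm.
Qed.

(** Along the curve z_i = t^(c_i), with [c] a separating weight, the series has the
    single lowest term f_a t^W, which cannot be cancelled as t tends to 0. *)
Lemma fun_of_inj0 f : H2 f -> (forall z, unit_ball z -> fun_of f z = 0) -> f = 0.
Proof.
move=> fH fz; apply: contrapT => /separating_weight[a fa [c c0 cmin]].
pose W m := (\sum_(i < d) m i * c i)%N.
pose zt (t : R) : d.-tuple R[i] := [tuple (t ^+ c i)%:C | i < d].
have monomE t m : monom (tnth (zt t)) m = (t ^+ W m)%:C.
  rewrite /monom /W -prodrXr rmorph_prod; apply: eq_bigr => i _.
  by rewrite tnth_mktuple -rmorphXn -exprM mulnC.
pose t0 : R := d.+1%:R^-1.
have t0_gt0 : 0 < t0 by rewrite invr_gt0.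
have ball t : 0 <= t <= t0 -> unit_ball (zt t).
  move=> /andP[t_ge0 tt0]; apply/unit_ballP; rewrite /sqabs.
  apply: (@le_lt_trans _ _ (\sum_(i < d) t0)).
    apply: ler_sum => i _; rewrite tnth_mktuple nsqC -exprM.
    have t1 : t0 <= 1 by rewrite invf_le1// ler1n.
    apply: le_trans (tt0).
    have t_le1 : t <= 1 by exact: le_trans tt0 t1.
    by rewrite -[leRHS]expr1; apply: ler_wiXn2l => //; rewrite muln_gt0 c0.
  by rewrite sumr_const card_ord -mulr_natl ltr_pdivrMr// mul1r ltr_nat.
have k0H : H2 (kern (zt t0)) by apply/H2_kern/ball; rewrite lexx ltW.
have [C] := abssum_inner fH k0H; rewrite inner_kern_term.
pose u m := normc (f m) * t0 ^+ W m.
rewrite (_ : (fun m => normc _) = u); last first.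
  by apply/funext => m; rewrite monomE normc_realM// exprn_ge0// ltW.
have u_ge0 m : 0 <= u m by rewrite mulr_ge0 ?normc_ge0// exprn_ge0// ltW.
move=> uC; pose A := u a.
have A_gt0 : 0 < A.
  rewrite mulr_gt0 ?exprn_gt0// lt_neqAle normc_ge0 andbT eq_sym.
  by apply: contra fa => /eqP /ComplexField.Normc.eq0_normc ->.
have AC : A <= C by apply: le_trans (uC (mdeg a).+1); exact: term_le_psum.
have C_gt0 : 0 < C by exact: lt_le_trans AC.
(* all other terms have weight at least W a + 1, whence the extra factor s *)
have key (s : R) : 0 < s <= 1 -> A * s ^+ W a <= s ^+ (W a).+1 * C.
  move=> /andP[s0 s1].
  have bs : unit_ball (zt (t0 * s)).
    by apply: ball; rewrite mulr_ge0 ?(ltW s0) ?(ltW t0_gt0)//= ler_piMr// ltW.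
  have := cvg_fun_of fH bs; rewrite fz// => /cvgcP.
  under eq_fun do rewrite subr0.
  move=> lim0.
  have lim1 : normc (psum (fun m => f m * monom (tnth (zt (t0 * s))) m) n) +
      s ^+ (W a).+1 * C @[n --> \oo] --> 0 + s ^+ (W a).+1 * C.
    exact: cvgD lim0 (cvg_cst _).
  rewrite -[leRHS]add0r; apply: (ler_cvg_to (cvg_cst _) lim1).
  exists (mdeg a).+1 => // n /= an.
  have tailE m : normc (f m * monom (tnth (zt (t0 * s))) m) = u m * s ^+ W m.
    rewrite monomE normc_realM ?exprMn ?mulrA//.
    by rewrite mulr_ge0// exprn_ge0// ltW.
  rewrite -lerBlDr.
  have yC : normc (\sum_(m : bmultinom d n | m != BMultinom an)
      f m * monom (tnth (zt (t0 * s))) m) <= s ^+ (W a).+1 * C.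
    apply: le_trans (normc_sum _ _ _) _.
    apply: le_trans (_ : s ^+ (W a).+1 * psum u n <= _); last first.
      by rewrite ler_wpM2l ?exprn_ge0 ?(ltW s0).
    rewrite /psum [in leRHS](bigD1 (BMultinom an)) //= mulrDr.
    apply: ler_wpDl; first by rewrite mulr_ge0// exprn_ge0// ltW.
    rewrite mulr_sumr; apply: ler_sum => m ma; rewrite tailE mulrC.
    have [f0|f0] := eqVneq (f m) 0.
      by rewrite /u f0 ComplexField.Normc.normc0 mul0r !mulr0.
    rewrite ler_wpM2r ?u_ge0// ler_wiXn2l ?(ltW s0)//.
    by apply: cmin => //; rewrite -val_eqE in ma.
  rewrite /psum [X in normc X](bigD1 (BMultinom an)) //=.
  have -> : A * s ^+ W a = normc (f a * monom (tnth (zt (t0 * s))) a) by rewrite -tailE.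
  set x := f a * _; set y := (X in normc (x + X)).
  have : normc x <= normc (x + y) + normc y.
    by rewrite -{1}(addrK y x); apply: le_trans (le_normcD _ _) _; rewrite normcN.
  by move=> h; rewrite lerBlDr; apply: le_trans h _; rewrite lerD2l; exact: yC.
have s01 : 0 < A / (2 * C) <= 1.
  have C2 : 0 < 2 * C by rewrite mulr_gt0.
  rewrite (divr_gt0 A_gt0 C2) /= ler_pdivrMr// mul1r.
  by apply: le_trans AC _; rewrite ler_peMl ?ler1n// ltW.
have /andP[s0 _] := s01.
have := key _ s01; rewrite exprSr -mulrA [_ * (_ * C)]mulrC.
rewrite ler_pM2r ?exprn_gt0//.
rewrite (_ : A / (2 * C) * C = A / 2); last by field; rewrite gt_eqF.
by lra.
Qed.

End identity.

(** * Multiplication by polynomials inside a submodule *)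

Section submodule.
Local Open Scope ring_scope.
Variables (R : realType) (d : nat).
Implicit Types (f g h : multinom d -> R[i]) (z : d.-tuple R[i]) (i : 'I_d).
Implicit Types (m a b : multinom d) (c : multinom d -> R[i]) (M : set (multinom d -> R[i])).
Local Notation w := (@monomial_sqnorm R d).

Lemma mult_opP (phi : d.-tuple R[i] -> R[i]) f : multiplier phi -> H2 f ->
  is_product phi f (mult_op phi f).
Proof. by move=> mphi fH; apply: xgetPex; exact: mphi. Qed.

Lemma fun_ofB f g z : H2 f -> H2 g -> unit_ball z ->
  fun_of (f - g) z = fun_of f z - fun_of g z.
Proof.
by move=> fH gH zb; rewrite -!inner_kern innerBl//; exact: H2_kern.
Qed.

Lemma fun_of_inj f g : H2 f -> H2 g ->
  (forall z, unit_ball z -> fun_of f z = fun_of g z) -> f = g.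
Proof.
move=> fH gH fg; apply/eqP; rewrite -subr_eq0; apply/eqP.
apply: fun_of_inj0; first exact: H2B.
by move=> z zb; rewrite fun_ofB// fg// subrr.
Qed.

(** The identity theorem is what identifies the multiplier with the shift of the
    coefficients, and gives access to norms. *)
Lemma mult_op_coord f i : H2 f -> mult_op (fun z => tnth z i) f = shift i f.
Proof.
move=> fH; rewrite /mult_op; case: xgetP => [g _ [gH gE]|/(_ (shift i f))[]].
  apply: fun_of_inj => //; first exact: H2_shift.
  by move=> z zb; rewrite gE// fun_of_shift.
by split; [exact: H2_shift|move=> z zb; rewrite fun_of_shift].
Qed.

Definition delta b m : R[i] := (m == b)%:R.

Definition trunc n f := \sum_(b : bmultinom d n) f b *: delta b.

Lemma sumfE (I : Type) (r : seq I) (P : pred I) (F : I -> multinom d -> R[i]) m :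
  (\sum_(k <- r | P k) F k) m = \sum_(k <- r | P k) F k m.
Proof. by elim/big_ind2 : _ => // x1 x2 y1 y2 <- <-. Qed.

Lemma truncE n f m : trunc n f m = if (mdeg m < n)%N then f m else 0.
Proof.
rewrite /trunc sumfE; case: ifPn => mn.
  rewrite (bigD1 (BMultinom mn)) //= big1 ?addr0 => [|b bm].
    by rewrite -[_ m]/(_ * _) /delta eqxx mulr1.
  rewrite -[_ m]/(_ * _) /delta; case: eqP => [mb|_]; last by rewrite mulr0.
  by move: bm; rewrite -val_eqE /= mb eqxx.
rewrite big1// => b _; rewrite -[_ m]/(_ * _) /delta; case: eqP => [mb|_].
  by move: mn; rewrite mb bmdeg.
by rewrite mulr0.
Qed.

Lemma H2_delta b : H2 (delta b).
Proof.
apply: (@H2_le _ _ _ (w b)) => n; rewrite /psum.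
have wE m : wsq (delta b) m = if m == b then w b else 0.
  by rewrite /wsq /delta; case: eqP => [->|_]; rewrite /nsq /=; ring.
have [bn|bn] := ltnP (mdeg b) n.
  rewrite (bigD1 (BMultinom bn)) //= wE eqxx big1 ?addr0// => m mb.
  by rewrite wE; case: eqP => // e; move: mb; rewrite -val_eqE /= e eqxx.
rewrite big1 ?ltW ?w_gt0// => m _; rewrite wE; case: eqP => // e.
by move: bn; rewrite -e leqNgt bmdeg.
Qed.

Lemma trunc_cvg f : H2 f -> forall e : R, 0 < e -> exists n, nrm2 (f - trunc n f) < e.
Proof.
move=> fH e e0.
have /cvgrPdist_lt/(_ _ e0)[n _ /(_ n (leqnn n))] := cvg_nrm2 fH.
rewrite -/(nrm2 f) ger0_norm ?subr_ge0 ?psum_nrm2// => fn.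
exists n; apply: le_lt_trans fn; apply: nrm2_le => k.
apply: le_trans (psum_nondecreasing _ (leq_maxl k n)) _; first exact: wsq_ge0.
rewrite lerBrDr; apply: le_trans (psum_nrm2 (maxn k n) fH).
pose low (m : bmultinom d (maxn k n)) := (mdeg m < n)%N.
rewrite (psum_widen (wsq f) (leq_maxr k n)) /psum [in leRHS](bigID low) /=.
rewrite [X in _ <= X]addrC lerD2r// (bigID low) /=.
have fE m : (f - trunc n f) m = f m - trunc n f m by [].
rewrite big1 ?add0r => [|m]; rewrite /low; last first.
  by move=> mn; rewrite /wsq fE truncE mn subrr nsq0 mulr0.
by apply: ler_sum => m mn; rewrite /wsq fE truncE (negbTE mn) subr0.
Qed.

(** Multiplication by the monomial z^a. *)
Definition mshift a f m : R[i] := if mpoly.lem a m then f (mnm_sub m a) else 0.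

Lemma mshift0 f : mshift mnm0 f = f.
Proof.
apply/funext => m; rewrite /mshift subm0 (_ : mpoly.lem _ _)//.
by apply/mnm_lepP => i; rewrite mnm0E.
Qed.

Lemma mshift_up i a f : mshift (up i a) f = shift i (mshift a f).
Proof.
apply/funext => m; rewrite /shift /mshift; case: eqP => [mi|/eqP mi].
  case: ifPn => // /mnm_lepP/(_ i); by rewrite upE mi.
rewrite submDA [mnm_add (mnm1 i) a]addmC.
suff -> : mpoly.lem (up i a) m = mpoly.lem a (down i m) by [].
apply/mnm_lepP/mnm_lepP => am j; have := am j; rewrite mnmDE mnmBE mnm1E.
  by case: eqP => [<-|_] /=; lia.
by case: eqP => [<-|_] /=; move: mi; rewrite -lt0n; lia.
Qed.

Lemma mnm_ind (P : multinom d -> Prop) :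
  P mnm0 -> (forall i a, P a -> P (up i a)) -> forall a, P a.
Proof.
move=> P0 PS a; have [n] := ubnP (mdeg a); elim: n a => // n IH a an.
have [->//|a0] := eqVneq a mnm0.
have [i ai] : exists i, a i != 0%N.
  apply: contrapT => na; move/eqP: a0; apply; apply/mnmP => i; rewrite mnm0E.
  by apply/eqP/negPn/negP => ai; apply: na; exists i.
rewrite -(downK ai); apply: PS; apply: IH.
by move: an; rewrite -[in X in X -> _](downK ai) mdegD mdeg1 addn1 ltnS.
Qed.

Lemma H2_mshift a f : H2 f -> H2 (mshift a f).
Proof.
move=> fH; elim/mnm_ind: a => [|i a IH]; first by rewrite mshift0.
by rewrite mshift_up; exact: H2_shift.
Qed.

Lemma nrm2_mshift a f : H2 f -> nrm2 (mshift a f) <= nrm2 f.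
Proof.
move=> fH; elim/mnm_ind: a => [|i a IH]; first by rewrite mshift0.
by rewrite mshift_up; apply: le_trans IH; apply: nrm2_shift; exact: H2_mshift.
Qed.

Lemma mshiftD a f g : mshift a (f + g) = mshift a f + mshift a g.
Proof.
apply/funext => m; rewrite -[RHS]/(mshift a f m + mshift a g m) /mshift.
by case: ifP => // _; rewrite addr0.
Qed.

Lemma mshiftZ a (x : R[i]) f : mshift a (x *: f) = x *: mshift a f.
Proof.
apply/funext => m; rewrite -[RHS]/(x * mshift a f m) /mshift.
by case: ifP => // _; rewrite mulr0.
Qed.

(** Closure under the coordinates, iterated. *)
Lemma sub_mshift M a f : closed_submodule M -> M f -> M (mshift a f).
Proof.
move=> [M2 M0 Mlin Mz Mcl] Mf; elim/mnm_ind: a => [|i a IH]; first by rewrite mshift0.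
by rewrite mshift_up -mult_op_coord; [exact: Mz|exact: M2].
Qed.

(** Multiplication by the polynomial whose coefficients are the values of [c] in
    degree < N. *)
Definition pmul N c f := psum (fun a => c a *: mshift a f) N.

Lemma pmulD N c f g : pmul N c (f + g) = pmul N c f + pmul N c g.
Proof.
by rewrite -psumD; congr psum; apply/funext => a; rewrite mshiftD scalerDr.
Qed.

Lemma pmulZ N c (x : R[i]) f : pmul N c (x *: f) = x *: pmul N c f.
Proof.
rewrite /pmul /psum scaler_sumr; apply: eq_bigr => a _.
by rewrite mshiftZ scalerA mulrC -scalerA.
Qed.

Lemma pmul0 N c : pmul N c 0 = 0.
Proof. by have := pmulZ N c 0 0; rewrite !scale0r. Qed.

Lemma pmulB N c f g : pmul N c (f - g) = pmul N c f - pmul N c g.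
Proof. by rewrite pmulD -(scaleN1r g) pmulZ scaleN1r. Qed.

Lemma H2_pmul N c f : H2 f -> H2 (pmul N c f).
Proof.
by move=> fH; apply: H2_sum => a _; apply: H2Z; exact: H2_mshift.
Qed.

(** Finite sums preserve bounds that are uniform in a parameter [t].  Only the
    existence of a constant matters, so |f + g|^2 <= 2 |f|^2 + 2 |g|^2 suffices. *)
Lemma nrm2_sum_uniform (I : Type) (T : Type) (D : T -> Prop) (r : seq I)
    (F : I -> T -> multinom d -> R[i]) (L : T -> R) :
  (forall k t, D t -> H2 (F k t)) ->
  (forall k, exists C, forall t, D t -> nrm2 (F k t) <= C * L t) ->
  exists C, forall t, D t -> nrm2 (\sum_(k <- r) F k t) <= C * L t.
Proof.
move=> FH FC; elim: r => [|k r [C rC]].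
  exists 0 => t Dt; rewrite big_nil mul0r; apply: nrm2_le => n.
  by rewrite /psum big1// => m _; rewrite /wsq nsq0 mulr0.
have [C' kC] := FC k.
exists (2 * C' + 2 * C) => t Dt; rewrite big_cons.
apply: le_trans (nrm2D_le _ _) _; first exact: FH.
  by apply: H2_sum => j _; exact: FH.
by have := kC _ Dt; have := rC _ Dt; lra.
Qed.

Lemma nrm2_pmul N c : exists C, forall f, H2 f -> nrm2 (pmul N c f) <= C * nrm2 f.
Proof.
apply: (@nrm2_sum_uniform _ _ (@H2 R d) _ (fun (a : bmultinom d N) f => c a *: mshift a f)).
- by move=> a f fH; apply: H2Z; exact: H2_mshift.
- move=> a; exists (nsq (c a)) => f fH; rewrite nrm2Z; last exact: H2_mshift.
  by rewrite ler_wpM2l ?nsq_ge0//; exact: nrm2_mshift.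
Qed.

(** The product of [c] by a monomial, read from the other factor: this is how
    [pmul N c] sends polynomials to polynomial multiples of [c]. *)
Lemma pmul_delta N c b : (forall m, (N <= mdeg m)%N -> c m = 0) ->
  pmul N c (delta b) = mshift b c.
Proof.
move=> cN; apply/funext => m; rewrite /pmul /psum sumfE.
have E a : (c a *: mshift a (delta b)) m = if m == mnm_add a b then c a else 0.
  rewrite -[LHS]/(c a * mshift a (delta b) m) /mshift /delta.
  case: (m =P mnm_add a b) => [->|mab].
    rewrite (_ : mpoly.lem _ _); last exact: lem_addr.
    by rewrite [mnm_add a b]addmC addmK eqxx mulr1.
  case: ifPn => am; last by rewrite mulr0.
  case: eqP => e; last by rewrite mulr0.
  by case: mab; rewrite -e addmC submK.
under eq_bigr do rewrite E.
rewrite /mshift; case: ifPn => bm; last first.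
  rewrite big1// => a _; case: eqP => // e; move: bm; rewrite e lem_addl//.
have [mN|mN] := ltnP (mdeg (mnm_sub m b)) N; last first.
  rewrite cN// big1// => a _; case: eqP => // e.
  by move: mN; rewrite e addmK leqNgt bmdeg.
rewrite (bigD1 (BMultinom mN)) //= submK// eqxx big1 ?addr0// => a am.
case: eqP => // e; move: am; rewrite -val_eqE /= e addmK eqxx//.
Qed.

(** A submodule containing the polynomial [c] contains [c f] for every [f] of the
    space: polynomials [f] are clear, and multiplication by [c] is bounded. *)
Lemma sub_pmul M N c f : closed_submodule M -> M c ->
  (forall m, (N <= mdeg m)%N -> c m = 0) -> H2 f -> M (pmul N c f).
Proof.
move=> hM Mc cN fH; have [M2 M0 Mlin Mz Mcl] := hM.
apply: Mcl; first exact: H2_pmul.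
move=> e e0.
have [C C0 HC] : exists2 C, 0 < C & forall f, H2 f -> nrm2 (pmul N c f) <= C * nrm2 f.
  have [C HC] := nrm2_pmul N c; exists (`|C| + 1); first by rewrite ltr_wpDl.
  move=> g gH; apply: le_trans (HC _ gH) _; rewrite ler_wpM2r ?nrm2_ge0//.
  by apply: le_trans (ler_norm _) _; rewrite lerDl.
have [n fn] := trunc_cvg fH (divr_gt0 e0 C0).
have tH : H2 (trunc n f).
  by apply: H2_sum => b _; apply: H2Z; exact: H2_delta.
exists (pmul N c (trunc n f)).
  rewrite /trunc; elim/big_ind : _ => [|x y Mx My|b _]; first by rewrite pmul0.
    by rewrite pmulD -[pmul N c x]scale1r; exact: Mlin.
  rewrite pmulZ -[X in M X]addr0; apply: Mlin => //.
  by rewrite pmul_delta//; exact: sub_mshift.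
rewrite -pmulB sqnormE; last by apply: H2_pmul; exact: H2B.
rewrite lte_fin; apply: le_lt_trans (HC _ (H2B fH tH)) _.
by rewrite mulrC -ltr_pdivlMr.
Qed.

End submodule.

(** * Orthogonal projection on a closed submodule *)

Section projection.
Local Open Scope ring_scope.
Variables (R : realType) (d : nat).
Implicit Types (f g h : multinom d -> R[i]) (M : set (multinom d -> R[i])).

Lemma cvg_nsq (z : nat -> R[i]) l : z n @[n --> \oo] --> l ->
  nsq (z n) @[n --> \oo] --> nsq l.
Proof.
move=> /cvg_complexP[zr zi]; rewrite /nsq !expr2.
under eq_fun do rewrite !expr2.
by apply: cvgD; apply: cvgM.
Qed.

(** Lower semicontinuity of the norm under coefficientwise convergence. *)
Lemma nrm2_fatou (F : nat -> multinom d -> R[i]) (G : multinom d -> R[i])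
    (C : nat -> R) (l : R) :
  (forall m, F k m @[k --> \oo] --> G m) ->
  (\forall k \near \oo, H2 (F k) /\ nrm2 (F k) <= C k) ->
  C k @[k --> \oo] --> l -> H2 G /\ nrm2 G <= l.
Proof.
move=> FG FC Cl.
have key n : psum (wsq G) n <= l.
  have cF : psum (wsq (F k)) n @[k --> \oo] --> psum (wsq G) n.
    rewrite /psum; apply: cvg_big => [|m _]; first exact: add_continuous.
    by apply: cvgM; [exact: cvg_cst|exact: cvg_nsq].
  apply: (ler_cvg_to cF Cl); apply: filterS FC => k [FH]; apply: le_trans.
  exact: psum_nrm2.
by split; [exact: H2_le key|exact: nrm2_le key].
Qed.

Lemma cvg_add_harmonic (a b : R) : a + b / n.+1%:R @[n --> \oo] --> a.
Proof.
rewrite -[X in _ --> X]addr0 -[X in a + X](mulr0 b).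
exact: cvgD (cvg_cst _) (cvgM (cvg_cst _) (@cvg_harmonic R)).
Qed.

(** A minimizing sequence is Cauchy by the parallelogram identity and converges
    coefficientwise; by lower semicontinuity its limit is a minimizer. *)
Lemma projection_exists M f : closed_submodule M -> H2 f ->
  exists g, M g /\ forall h, M h -> inner (f - g) h = 0.
Proof.
move=> [M2 M0 Mlin _ Mcl] fH.
have MB a g h : M g -> M h -> M (g + a *: h) by move=> Mg Mh; rewrite addrC; exact: Mlin.
pose E := [set nrm2 (f - g) | g in M].
have E0 : lbound E 0.
  by move=> _ [g Mg <-]; apply: nrm2_ge0; apply: H2B => //; exact: M2.
have Einf : has_inf E by split; [exists (nrm2 (f - 0)); exists 0 | exists 0].
pose de := inf E.
have deE g : M g -> de <= nrm2 (f - g).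
  by move=> Mg; apply: ge_inf; [exists 0|exists g].
have /choice[g gP] n : exists g, M g /\ nrm2 (f - g) < de + 1 / n.+1%:R.
  have /(_ _ Einf)[|_ [g Mg <-] lt] := @inf_adherent R E (1 / n.+1%:R).
    by rewrite divr_gt0.
  by exists g.
have gH n : H2 (g n) by apply: M2; case: (gP n).
have gcauchy n k : (n <= k)%N -> nrm2 (g k - g n) <= 4 / n.+1%:R.
  move=> nk; have [Mn ltn] := gP n; have [Mk ltk] := gP k.
  have mid : M (2^-1 *: (g n + g k)).
    rewrite -[X in M X]addr0; apply: Mlin => //.
    by rewrite addrC -[g n]scale1r; exact: MB.
  have := nrm2_parallelogram (H2B fH (gH n)) (H2B fH (gH k)).
  rewrite (_ : f - g n + (f - g k) = 2 *: (f - 2^-1 *: (g n + g k))); last first.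
    rewrite scalerBr scalerA divff ?pnatr_eq0// scale1r scaler_nat mulr2n opprD.
    by rewrite addrACA.
  rewrite (_ : f - g n - (f - g k) = g k - g n); last first.
    by rewrite opprB addrC addrA subrK.
  rewrite nrm2Z; last by apply: H2B => //; exact: M2.
  rewrite (_ : nsq 2 = 4); last by rewrite /nsq /=; ring.
  have := deE _ mid.
  have : 1 / k.+1%:R <= 1 / n.+1%:R :> R.
    by rewrite !mul1r lef_pV2 ?posrE ?ler_nat.
  move: ltn ltk; rewrite !mul1r.
  move: (n.+1%:R^-1) (k.+1%:R^-1) => u v ltn ltk; lra.
pose gl m := limn (fun n => g n m).
have glP m : g n m @[n --> \oo] --> gl m.
  apply: (@nsq_cauchy_cvg _ _ (fun n => 0 + (4 / monomial_sqnorm R m) / n.+1%:R)).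
    exact: cvg_add_harmonic.
  move=> n k nk; rewrite add0r mulrAC ler_pdivlMr ?w_gt0// mulrC.
  apply: le_trans (gcauchy _ _ nk); apply: le_trans (psum_nrm2 (mdeg m).+1 _).
    by apply: (@term_le_psum _ _ (wsq (g k - g n))) => // j; exact: wsq_ge0.
  exact: H2B.
have glH n : H2 (gl - g n) /\ nrm2 (gl - g n) <= 4 / n.+1%:R.
  apply: (@nrm2_fatou (fun k => g k - g n) _ (fun=> 4 / n.+1%:R)); last exact: cvg_cst.
    by move=> m; exact: cvgB (glP m) (cvg_cst _).
  by exists n => // k /= nk; split; [exact: H2B|exact: gcauchy].
have glH2 : H2 gl by rewrite -(subrK (g 0%N) gl); apply: H2D => //; exact: (glH 0%N).1.
have Mgl : M gl.
  apply: Mcl => // e e0.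
  have [n nlt] : exists n, 4 / n.+1%:R < e.
    have /cvgrPdist_lt/(_ _ e0)[n _ /(_ n (leqnn n))] := @cvg_add_harmonic 0 4.
    by rewrite !add0r normrN ger0_norm ?divr_ge0// => ?; exists n.
  exists (g n); first by case: (gP n).
  by rewrite sqnormE ?lte_fin; [exact: le_lt_trans (glH n).2 nlt|exact: (glH n).1].
have flH : H2 (f - gl) by exact: H2B.
have fl_le : nrm2 (f - gl) <= de.
  apply: (@nrm2_fatou (fun k => f - g k) _ (fun n => de + 1 / n.+1%:R) _ _ _ _).2.
  - by move=> m; exact: cvgB (cvg_cst _) (glP m).
  - by apply: nearW => k; split; [exact: H2B|exact: ltW (gP k).2].
  - exact: cvg_add_harmonic.
exists gl; split => // h Mh; have hH := M2 _ Mh.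
(* perturbing the minimizer by a small multiple of <f - gl, h> h *)
set x := inner (f - gl) h.
have key (t : R) : 0 <= t ^+ 2 * nsq x * nrm2 h - 2 * t * nsq x.
  have H' : H2 ((t%:C * x) *: h) by exact: H2Z.
  have : de <= nrm2 (f - (gl + (t%:C * x) *: h)) by apply: deE; exact: MB.
  rewrite opprD addrA nrm2B// nrm2Z// nsqM nsqC innerZr// -/x conjM conjR.
  rewrite Re_mulJ.
  by lra.
apply: nsq_eq0; apply/eqP; rewrite eq_le nsq_ge0 andbT leNgt; apply/negP => x0.
have h0 := nrm2_ge0 hH.
have := key (nrm2 h + 1)^-1; set t := _^-1.
have t0 : 0 < t by rewrite invr_gt0; lra.
rewrite (_ : _ - _ = (t * nsq x) * (t * nrm2 h - 2)); last by ring.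
rewrite pmulr_rge0; last by rewrite mulr_gt0.
have : t * (nrm2 h + 1) = 1 by rewrite /t mulVf// gt_eqF//; lra.
by rewrite mulrDr mulr1; lra.
Qed.

Lemma orth_projP M f : closed_submodule M -> H2 f ->
  M (orth_proj M f) /\ forall h, M h -> inner (f - orth_proj M f) h = 0.
Proof.
move=> hM fH; exact: (xgetPex 0 (projection_exists hM fH)).
Qed.

Lemma orth_proj_le M f g : closed_submodule M -> H2 f -> M g ->
  nrm2 (f - orth_proj M f) <= nrm2 (f - g).
Proof.
move=> hM fH Mg; have [MP orth] := orth_projP hM fH.
have [M2 M0 Mlin _ Mcl] := hM.
have PH := M2 _ MP; have gH := M2 _ Mg.
have MPg : M (orth_proj M f - g).
  by rewrite addrC -(scaleN1r g); exact: Mlin.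
rewrite -[in leRHS](subrK (orth_proj M f) f) -[X in _ <= nrm2 X]addrA.
rewrite [in leRHS]nrm2D ?orth//; [|exact: H2B|exact: H2B].
by rewrite mulr0 addr0 lerDl nrm2_ge0//; exact: H2B.
Qed.

End projection.

(** * Distance of a kernel to a submodule containing a polynomial *)

Section estimate.
Local Open Scope ring_scope.
Variables (R : realType) (d : nat).
Implicit Types (f g h : multinom d -> R[i]) (z : d.-tuple R[i]) (i : 'I_d).
Implicit Types (m a b : multinom d) (c : multinom d -> R[i]) (M : set (multinom d -> R[i])).
Local Notation w := (@monomial_sqnorm R d).

(** The kernel is an eigenvector of the adjoint of each coordinate multiplication;
    this measures how far it is from being one of the multiplications themselves. *)
Definition eigen_defect z : R :=
  \sum_(i < d) nrm2 (shift i (kern z) - tnth z i *: kern z).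

Lemma eigen_defect_ge0 z : unit_ball z -> 0 <= eigen_defect z.
Proof.
move=> zb; apply: sumr_ge0 => i _; apply: nrm2_ge0; apply: H2B.
  by apply: H2_shift; exact: H2_kern.
by apply: H2Z; exact: H2_kern.
Qed.

Lemma nsq_monom_le1 z a : unit_ball z -> nsq (monom (tnth z) a) <= 1.
Proof.
move=> /unit_ballP z1; rewrite nsq_monom /monom; apply: numdomain.Num.Theory.prodr_ile1 => i _.
rewrite exprn_ge0 ?nsq_ge0// exprn_ile1 ?nsq_ge0//.
apply: le_trans (ltW z1); rewrite /sqabs (bigD1 i) //= lerDl.
by apply: sumr_ge0 => j _; exact: nsq_ge0.
Qed.

Lemma shiftB i f g : shift i (f - g) = shift i f - shift i g.
Proof.
apply/funext => m; rewrite -[RHS]/(shift i f m - shift i g m) !shiftE.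
by case: eqP => // _; rewrite subr0.
Qed.

Lemma shiftZ i (x : R[i]) f : shift i (x *: f) = x *: shift i f.
Proof.
apply/funext => m; rewrite -[RHS]/(x * shift i f m) !shiftE.
by case: eqP => // _; rewrite mulr0.
Qed.

(** Induction on [a] through
    z_i z^a k - l_i l^a k = z_i (z^a k - l^a k) + l^a (z_i k - l_i k),
    using that coordinate multiplications are contractions and |l^a| <= 1. *)
Lemma mshift_kern_le a : exists C, forall z, unit_ball z ->
  nrm2 (mshift a (kern z) - monom (tnth z) a *: kern z) <= C * eigen_defect z.
Proof.
elim/mnm_ind: a => [|i a [C HC]].
  exists 0 => z zb; rewrite mshift0 /monom big1; last by move=> i _; rewrite mnm0E.
  rewrite scale1r subrr mul0r; apply: nrm2_le => n.
  by rewrite /psum big1// => m _; rewrite /wsq nsq0 mulr0.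
exists (2 * C + 2) => z zb.
have kH := H2_kern zb.
have dH : H2 (mshift a (kern z) - monom (tnth z) a *: kern z).
  by apply: H2B; [exact: H2_mshift|exact: H2Z].
have eH : H2 (shift i (kern z) - tnth z i *: kern z).
  by apply: H2B; [exact: H2_shift|exact: H2Z].
rewrite (_ : _ - _ = shift i (mshift a (kern z) - monom (tnth z) a *: kern z) +
    monom (tnth z) a *: (shift i (kern z) - tnth z i *: kern z)); last first.
  rewrite mshift_up monom_up shiftB shiftZ scalerBr scalerA [tnth z i * _]mulrC.
  by rewrite addrA subrK.
apply: le_trans (nrm2D_le (H2_shift _ dH) (H2Z _ eH)) _.
have e1 := HC _ zb; have e2 := nrm2_shift i dH.
have e3 : nrm2 (monom (tnth z) a *: (shift i (kern z) - tnth z i *: kern z)) <=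
    eigen_defect z.
  rewrite nrm2Z//; apply: le_trans (_ : nrm2 (shift i (kern z) - tnth z i *: kern z) <= _).
    by rewrite ler_piMl ?nrm2_ge0// nsq_monom_le1.
  rewrite /eigen_defect (bigD1 i) //= lerDl; apply: sumr_ge0 => j _.
  by apply: nrm2_ge0; apply: H2B; [exact: H2_shift|exact: H2Z].
lra.
Qed.

Definition peval N c z := psum (fun m => c m * monom (tnth z) m) N.

Lemma pmul_kern_le N c : exists C, forall z, unit_ball z ->
  nrm2 (pmul N c (kern z) - peval N c z *: kern z) <= C * eigen_defect z.
Proof.
have [] := @nrm2_sum_uniform R d (bmultinom d N) _ (@unit_ball R d)
  (index_enum (bmultinom d N : finType))
  (fun (a : bmultinom d N) z => c a *: (mshift a (kern z) - monom (tnth z) a *: kern z))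
  eigen_defect.
- move=> a z zb; apply: H2Z; apply: H2B; first by apply: H2_mshift; exact: H2_kern.
  by apply: H2Z; exact: H2_kern.
- move=> a; have [C HC] := mshift_kern_le a.
  exists (nsq (c a) * C) => z zb; have kH := H2_kern zb.
  rewrite nrm2Z; last by apply: H2B; [exact: H2_mshift|exact: H2Z].
  by rewrite -mulrA ler_wpM2l ?nsq_ge0// HC.
move=> C HC; exists C => z zb; apply: le_trans (HC _ zb).
rewrite le_eqVlt; apply/orP; left; apply/eqP; congr nrm2.
rewrite /pmul /peval /psum scaler_suml -sumrB; apply: eq_bigr => a _.
by rewrite scalerBr scalerA.
Qed.

Definition kern_rest M z := kern z - orth_proj M (kern z).

(** P_M k_z is the point of M nearest to k_z, and p k_z / p(z) is a competitor. *)
Lemma kern_rest_le M N c : closed_submodule M -> M c ->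
  (forall m, (N <= mdeg m)%N -> c m = 0) ->
  exists2 C, 0 <= C & forall z, unit_ball z ->
    nsq (peval N c z) * nrm2 (kern_rest M z) <= C * eigen_defect z.
Proof.
move=> hM Mc cN; have [C HC] := pmul_kern_le N c.
exists `|C| => // z zb; have kH := H2_kern zb.
have {}HC : nrm2 (pmul N c (kern z) - peval N c z *: kern z) <= `|C| * eigen_defect z.
  apply: le_trans (HC _ zb) _; rewrite ler_wpM2r ?eigen_defect_ge0//.
  exact: ler_norm.
have [->|c0] := eqVneq (peval N c z) 0.
  by rewrite nsq0 mul0r mulr_ge0// eigen_defect_ge0.
apply: le_trans HC.
have Mpk : M ((peval N c z)^-1 *: pmul N c (kern z)).
  have [_ M0 Mlin _ _] := hM; rewrite -[X in M X]addr0; apply: Mlin => //.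
  exact: sub_pmul.
have := orth_proj_le hM kH Mpk; rewrite -/(kern_rest M z) => le.
rewrite [leRHS](_ : _ =
    nsq (peval N c z) * nrm2 (kern z - (peval N c z)^-1 *: pmul N c (kern z))).
  by rewrite ler_wpM2l ?nsq_ge0.
rewrite -nrm2Z; last by apply: H2B => //; apply: H2Z; exact: H2_pmul.
by rewrite scalerBr scalerA divff// scale1r -nrm2N opprB.
Qed.

(** Expanding the squares, the cross terms are given by the reproducing property and
    the defect equals sum_i |z_i k|^2 - |z|^2 |k|^2.  Here
    (n + d)/(n + 1) <= 1 + d/(n + 1), and |k|^2 (1 - |z|^2) = 1. *)
Lemma eigen_defect_le z (E : R) : unit_ball z ->
  (forall n, \sum_(k < n) k.+1%:R^-1 * sqabs z ^+ k <= E) ->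
  eigen_defect z <= 1 + d%:R * E.
Proof.
move=> zb zE; have kH := H2_kern zb; have x1 := sqabs_ball zb.
have nk : nrm2 (kern z) = (1 - sqabs z)^-1 by exact: nrm2_kern.
have x1' : 1 - sqabs z != 0 by rewrite gt_eqF// subr_gt0; case/andP: x1.
have tE i : nrm2 (shift i (kern z) - tnth z i *: kern z) =
    nrm2 (shift i (kern z)) - nsq (tnth z i) * nrm2 (kern z).
  rewrite nrm2B; [|exact: H2_shift|exact: H2Z].
  rewrite nrm2Z// innerZr//; last exact: H2_shift.
  rewrite inner_kern fun_of_shift// -inner_kern inner_nrm2//.
  rewrite (_ : complex.Re _ = nsq (tnth z i) * nrm2 (kern z)); first by ring.
  by rewrite mulrA [_^* * _]mulrC mulcJ /=; ring.
rewrite /eigen_defect; under eq_bigr do rewrite tE.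
rewrite sumrB -mulr_suml -/(sqabs z).
have key : \sum_(i < d) nrm2 (shift i (kern z)) <= nrm2 (kern z) + d%:R * E.
  have cl : \sum_(i < d) psum (wsq (shift i (kern z))) n @[n --> \oo] -->
      \sum_(i < d) nrm2 (shift i (kern z)).
    apply: cvg_big => [|i _]; first exact: add_continuous.
    by apply: cvg_nrm2; exact: H2_shift.
  apply: (ler_cvg_to cl (cvg_cst _)); apply: nearW => n.
  apply: (@le_trans _ _ (\sum_(i < d) psum (wsq (shift i (kern z))) n.+1)).
    by apply: ler_sum => i _; apply: psum_nondecreasing => // m; exact: wsq_ge0.
  under eq_bigr do rewrite psum_wsq_shift.
  rewrite /psum exchange_big /=.
  apply: (@le_trans _ _ (psum (fun m => wsq (kern z) m +
      d%:R * ((mdeg m).+1%:R^-1 * wsq (kern z) m)) n)).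
    apply: ler_sum => m _; rewrite -mulr_suml sum_w_up /wsq.
    have n0 := nsq_ge0 (kern z m); have w0 := ltW (w_gt0 R m).
    rewrite [X in _ <= X](_ : _ = w m * (1 + d%:R / (mdeg m).+1%:R) * nsq (kern z m)).
      rewrite ler_wpM2r// -mulrA ler_wpM2l// ler_pdivrMr// mulrDl mul1r.
      by rewrite divfK ?pnatr_eq0// natrD lerD2r ler_nat.
    by ring.
  rewrite psumD psumZ (psum_wsq_kern (fun k => k.+1%:R^-1)).
  by apply: lerD; [exact: psum_nrm2|exact: ler_wpM2l].
have : nrm2 (kern z) * (1 - sqabs z) = 1 by rewrite nk mulVf.
by rewrite mulrBr mulr1 [nrm2 _ * sqabs _]mulrC; lra.
Qed.

Lemma inner_suml (I : Type) (r : seq I) (P : pred I) (F : I -> multinom d -> R[i]) g :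
  (forall k, P k -> H2 (F k)) -> H2 g ->
  inner (\sum_(k <- r | P k) F k) g = \sum_(k <- r | P k) inner (F k) g.
Proof.
move=> FH gH.
elim: r => [|k r IH]; first by rewrite !big_nil -(scale0r 0) innerZl ?mul0r//; exact: H20.
rewrite !big_cons; case: ifP => // Pk; rewrite innerDl ?IH//; first exact: FH.
exact: H2_sum.
Qed.

End estimate.

(** * The Gram identity *)

Section gram.
Local Open Scope ring_scope.
Variables (R : realType) (d : nat).
Implicit Types (f g h : multinom d -> R[i]) (z : d.-tuple R[i]) (i : 'I_d).
Implicit Types (m a b : multinom d) (c : multinom d -> R[i]) (M : set (multinom d -> R[i])).

Lemma nrm2_eq0 f : H2 f -> nrm2 f = 0 -> f = 0.
Proof.
move=> fH f0; apply/funext => m; apply: nsq_eq0.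
have := le_trans (term_le_psum (wsq_ge0 f) (ltnSn (mdeg m))) (psum_nrm2 _ fH).
rewrite f0 /wsq pmulr_rle0 ?w_gt0// => n0.
by apply/eqP; rewrite eq_le n0 nsq_ge0.
Qed.

(** The reproducing property gives the right-hand side the defining property of
    the adjoint at the kernel, and that property has only one solution. *)
Lemma adjoint_kern (phi : d.-tuple R[i] -> R[i]) z : multiplier phi -> unit_ball z ->
  adjoint (mult_op phi) (kern z) = (phi z)^* *: kern z.
Proof.
move=> mphi zb; have kH := H2_kern zb.
have spec f : H2 f -> inner (mult_op phi f) (kern z) = inner f ((phi z)^* *: kern z).
  move=> fH; have [_ pE] := mult_opP mphi fH.
  by rewrite innerZr// conjK !inner_kern pE.
rewrite /adjoint; case: xgetP => [h _ [hH hE]|/(_ ((phi z)^* *: kern z))[]]; last first.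
  by split => //; exact: H2Z.
have kH' := H2Z (phi z)^* kH; have dH := H2B hH kH'.
apply/eqP; rewrite -subr_eq0; apply/eqP; apply: nrm2_eq0 => //; apply: complexI.
by rewrite -inner_nrm2// innerBr// -spec// hE// subrr.
Qed.

Definition gram (P : pred nat) (phi : nat -> d.-tuple R[i] -> R[i]) z1 z2 N :=
  \sum_(0 <= n < N | P n) phi n z1 * (phi n z2)^*.

(** The strong sum at the kernel of [z2] is evaluated at [z1]; evaluation is
    continuous for the norm. *)
Lemma gram_cvg M len (phi : nat -> d.-tuple R[i] -> R[i]) z1 z2 :
  closed_submodule M ->
  (forall n, in_range len n -> multiplier (phi n)) ->
  strong_sum len (fun n => mult_op (phi n) \o adjoint (mult_op (phi n))) (orth_proj M) ->
  unit_ball z1 -> unit_ball z2 ->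
  gram (in_range len) phi z1 z2 N @[N --> \oo] -->
    1 - (1 - hdot z1 z2) * inner (kern_rest M z2) (kern_rest M z1).
Proof.
move=> hM hphi hsum b1 b2.
have [M2 M0 Mlin _ _] := hM.
have k1H := H2_kern b1; have k2H := H2_kern b2.
have [MP1 orth1] := orth_projP hM k1H; have [MP2 orth2] := orth_projP hM k2H.
have P1H := M2 _ MP1; have P2H := M2 _ MP2.
set Pk := orth_proj M (kern z2).
pose T n := mult_op (phi n) (adjoint (mult_op (phi n)) (kern z2)).
have TP n : in_range len n ->
    H2 (T n) /\ inner (T n) (kern z1) = phi n z1 * (phi n z2)^* * inner (kern z2) (kern z1).
  move=> nr; have mphi := hphi n nr; rewrite /T adjoint_kern//.
  have [TH TE] := mult_opP mphi (H2Z (phi n z2)^* k2H); split => //.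
  by rewrite inner_kern TE// -[fun_of (_ *: _) z1]inner_kern innerZl// mulrA.
pose S N := \sum_(0 <= n < N | in_range len n) T n.
have SH N : H2 (S N) by apply: H2_sum => n /TP[].
have SE N : inner (S N) (kern z1) =
    gram (in_range len) phi z1 z2 N * inner (kern z2) (kern z1).
  rewrite inner_suml//; last by move=> n /TP[].
  by rewrite /gram mulr_suml; apply: eq_bigr => n /TP[].
have nS : nrm2 (S N - Pk) @[N --> \oo] --> 0.
  have := hsum _ k2H; rewrite (_ : (fun N => _) = (fun N => (nrm2 (S N - Pk))%:E)); last first.
    by apply/funext => N; rewrite -sqnormE//; exact: H2B.
  by move=> /fine_cvg.
have cS : inner (S N) (kern z1) @[N --> \oo] --> inner Pk (kern z1).
  apply/cvgcP/cvgrPdist_lt => e e0.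
  have K0 : 0 < nrm2 (kern z1) + 1 by have := nrm2_ge0 k1H; lra.
  have e' : 0 < e ^+ 2 / (nrm2 (kern z1) + 1) by rewrite divr_gt0// exprn_gt0.
  move/cvgrPdist_lt: nS => /(_ _ e'); apply: filterS => N.
  have dH := H2B (SH N) P2H.
  rewrite !add0r !normrN !ger0_norm ?nrm2_ge0 ?normc_ge0// => lt.
  rewrite -innerBl// -(@ltr_pXn2r _ 2) ?nnegrE ?normc_ge0// ?ltW// nsqE.
  apply: le_lt_trans (cauchy_schwarz dH k1H) _.
  apply: le_lt_trans (_ : nrm2 (S N - Pk) * (nrm2 (kern z1) + 1) < _).
    by rewrite ler_wpM2l ?nrm2_ge0// lerDl.
  by rewrite -ltr_pdivlMr.
have K1 := inner_kern_kern b1 b2.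
have -> : gram (in_range len) phi z1 z2 =
    fun N => (1 - hdot z1 z2) * inner (S N) (kern z1).
  by apply/funext => N; rewrite SE mulrCA K1 mulr1.
have -> : 1 - (1 - hdot z1 z2) * inner (kern_rest M z2) (kern_rest M z1) =
    (1 - hdot z1 z2) * inner Pk (kern z1).
  have dH : H2 (kern_rest M z2) by exact: H2B.
  rewrite [inner _ (kern_rest M z1)]innerBr// (orth2 _ MP1) subr0 innerBl//.
  by rewrite mulrBr K1 opprB addrC subrK.
exact: cvgM (cvg_cst _) cS.
Qed.

Lemma H2_kern_rest M z : closed_submodule M -> unit_ball z -> H2 (kern_rest M z).
Proof.
move=> hM zb; have kH := H2_kern zb; have [Pk _] := orth_projP hM kH.
by apply: H2B => //; have [M2 _ _ _ _] := hM; exact: M2.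
Qed.

End gram.

(** Here [x] stands for the real part of an inner product of vectors with square
    norms [a] and [b]. *)
Lemma gram_limit_le (R : realType) (r s a b x : R) :
  0 <= 1 - r * s -> 0 <= b + a - 2 * x ->
  (1 - (1 - r ^+ 2) * a) + (1 - (1 - s ^+ 2) * b) - 2 * (1 - (1 - r * s) * x) <=
    (s - r) * (s * b - r * a).
Proof. by move=> rs1 dx; have := mulr_ge0 rs1 dx; lra. Qed.

Section radial.
Local Open Scope ring_scope.
Variables (R : realType) (d : nat).
Variables (M : set (multinom d -> R[i])) (len : option nat).
Variables (phi : nat -> d.-tuple R[i] -> R[i]) (z : d.-tuple R[i]).
Hypothesis hM : closed_submodule M.
Hypothesis hphi : forall n, in_range len n -> multiplier (phi n).
Hypothesis hsum : strong_sum len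
  (fun n => mult_op (phi n) \o adjoint (mult_op (phi n))) (orth_proj M).
Hypothesis z1 : sqabs z = 1.

Local Notation P := (in_range len).

Definition radial_rest r := nrm2 (kern_rest M (tscale r z)).

Lemma tnth_tscale r i : tnth (tscale r z) i = r%:C * tnth z i.
Proof. by rewrite tnth_mktuple. Qed.

Lemma sqabs_tscale r : sqabs (tscale r z) = r ^+ 2.
Proof.
rewrite /sqabs; under eq_bigr do rewrite tnth_tscale nsqM nsqC.
by rewrite -mulr_sumr -/(sqabs z) z1 mulr1.
Qed.

Lemma unit_ball_tscale r : 0 <= r < 1 -> unit_ball (tscale r z).
Proof. by move=> /andP[r0 r1]; apply/unit_ballP; rewrite sqabs_tscale expr_lt1. Qed.

Lemma hdot_tscale r s : hdot (tscale r z) (tscale s z) = (r * s)%:C.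
Proof.
rewrite /hdot; under eq_bigr do rewrite !tnth_tscale conjM conjR mulrACA mulcJ -!rmorphM.
by rewrite -rmorph_sum /= -mulr_sumr -/(sqabs z) z1 mulr1.
Qed.

Lemma sum_nsq_cvg r : 0 <= r < 1 ->
  \sum_(0 <= n < N | P n) nsq (phi n (tscale r z)) @[N --> \oo] -->
    1 - (1 - r ^+ 2) * radial_rest r.
Proof.
move=> r01; have b := unit_ball_tscale r01.
have /cvg_complexP[] := gram_cvg hM hphi hsum b b.
rewrite hdot_tscale inner_nrm2; last exact: H2_kern_rest.
rewrite -/(radial_rest r) => + _.
rewrite -(rmorph1 (real_complex R)) -!(rmorphB, rmorphM) /= -expr2.
rewrite (_ : (fun N => complex.Re _) =
  (fun N => \sum_(0 <= n < N | P n) nsq (phi n (tscale r z))))//.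
apply/funext => N; rewrite /gram raddf_sum; apply: eq_bigr => n _.
by rewrite mulcJ.
Qed.

(** The partial sums increase to a limit computed from four instances of the Gram
    identity, and [gram_limit_le] bounds this limit. *)
Lemma sum_nsqB_le N r s : 0 <= r -> r <= s -> s < 1 ->
  \sum_(0 <= n < N | P n) nsq (phi n (tscale r z) - phi n (tscale s z)) <=
    (s - r) * (s * radial_rest s - r * radial_rest r).
Proof.
move=> r0 rs s1.
have r01 : 0 <= r < 1 by rewrite r0 (le_lt_trans rs).
have s01 : 0 <= s < 1 by rewrite s1 (le_trans r0).
have br := unit_ball_tscale r01; have bs := unit_ball_tscale s01.
have hr := H2_kern_rest hM br; have hs := H2_kern_rest hM bs.
pose X N := \sum_(0 <= n < N | P n) nsq (phi n (tscale r z) - phi n (tscale s z)).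
pose x := complex.Re (inner (kern_rest M (tscale s z)) (kern_rest M (tscale r z))).
have Xcvg : X n @[n --> \oo] -->
    (1 - (1 - r ^+ 2) * radial_rest r) + (1 - (1 - s ^+ 2) * radial_rest s) -
      2 * (1 - (1 - r * s) * x).
  have /cvg_complexP[+ _] := gram_cvg hM hphi hsum br bs.
  rewrite hdot_tscale => rsl.
  have ReE : complex.Re (1 - (1 - (r * s)%:C) *
      inner (kern_rest M (tscale s z)) (kern_rest M (tscale r z))) = 1 - (1 - r * s) * x.
    by rewrite /x; case: (inner _ _) => a b /=; ring.
  rewrite ReE in rsl.
  rewrite (_ : X = fun k => \sum_(0 <= n < k | P n) nsq (phi n (tscale r z)) +
      \sum_(0 <= n < k | P n) nsq (phi n (tscale s z)) -
      2 * complex.Re (gram P phi (tscale r z) (tscale s z) k)).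
    exact: cvgB (cvgD (sum_nsq_cvg r01) (sum_nsq_cvg s01)) (cvgM (cvg_cst (2 : R)) rsl).
  apply/funext => k; rewrite /gram raddf_sum /=.
  have E n : nsq (phi n (tscale r z) - phi n (tscale s z)) =
      nsq (phi n (tscale r z)) + nsq (phi n (tscale s z)) -
      2 * complex.Re (phi n (tscale r z) * (phi n (tscale s z))^*).
    by rewrite conjE; case: (phi _ _) (phi _ _) => a b [a' b']; rewrite /nsq /=; ring.
  by rewrite /X (eq_bigr _ (fun n _ => E n)) sumrB big_split /= mulr_sumr.
have Xnd : {homo X : n k / (n <= k)%N >-> n <= k}.
  move=> n k nk; rewrite /X [leRHS](big_cat_nat (leq0n n) nk)//= lerDl.
  by apply: sumr_ge0 => j _; exact: nsq_ge0.
have := nondecreasing_cvgn_le Xnd (cvgP _ Xcvg) N; rewrite (cvg_lim _ Xcvg)// -/(X N).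
move=> /le_trans; apply.
have dx : 0 <= radial_rest s + radial_rest r - 2 * x.
  by rewrite /x /radial_rest -(nrm2B hs hr); exact: nrm2_ge0 (H2B hs hr).
have rs1 : 0 <= 1 - r * s.
  by case/andP: s01 => ? ?; rewrite subr_ge0 mulr_ile1// ?ltW//; case/andP: r01.
exact: gram_limit_le.
Qed.

End radial.

(** * Radial limits from an energy inequality *)

Section energy.
Local Open Scope ring_scope.
Variables (R : realType) (P : pred nat) (psi : nat -> R -> R[i]).
Variables (E g : R -> R) (C : R) (J : nat).

(** Radii with gaps 4^-j: an energy of order 2^j is then beaten by the length of
    the step. *)
Definition radius j : R := 1 - 4^-1 ^+ j.

Lemma radius_gap_gt0 j : 0 < 4^-1 ^+ j :> R. Proof. by rewrite exprn_gt0. Qed.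

Lemma radius_ge0 j : 0 <= radius j.
Proof. by rewrite subr_ge0 exprn_ile1// invf_le1// ler1n. Qed.

Lemma radius_lt1 j : radius j < 1.
Proof. by rewrite ltrBlDr ltrDl radius_gap_gt0. Qed.

Lemma cvg_expr_lt1 (x : R) : 0 <= x < 1 -> x ^+ n @[n --> \oo] --> (0 : R).
Proof. by move=> /andP[x0 x1]; apply: cvg_expr; rewrite ger0_norm. Qed.

Lemma radius_cvg : radius j @[j --> \oo] --> (1 : R).
Proof.
rewrite -[X in _ --> X]subr0; apply: cvgB; first exact: cvg_cst.
by apply: cvg_expr_lt1; rewrite invr_ge0 ler0n /= invf_lt1// ltr1n.
Qed.

Lemma radius_nondecreasing : {homo radius : j k / (j <= k)%N >-> j <= k}.
Proof.
move=> j k jk; rewrite lerD2l lerN2.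
by apply: ler_wiXn2l => //; rewrite invf_le1// ler1n.
Qed.

Lemma exists_radius_gt s : s < 1 -> exists j, s < radius j.
Proof.
move=> s1; have s1' : 0 < 1 - s by rewrite subr_gt0.
have /cvgrPdist_lt/(_ _ s1')[j _ /(_ j (leqnn j))] := radius_cvg.
rewrite gtr0_norm ?subr_gt0 ?radius_lt1// => h; exists j; lra.
Qed.

Local Notation sqdist N r s := (\sum_(0 <= n < N | P n) nsq (psi n r - psi n s)).

Hypothesis sqdist_energy : forall N r s, 0 <= r -> r <= s -> s < 1 ->
  sqdist N r s <= (s - r) * (E s - E r).
Hypothesis E_ge0 : forall r, 0 <= r < 1 -> 0 <= E r.
Hypothesis energy_dyadic : forall j, (J <= j)%N -> E (radius j) <= C * 2 ^+ j.
Hypothesis g_cvg : forall r, 0 <= r < 1 ->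
  \sum_(0 <= n < N | P n) nsq (psi n r) @[N --> \oo] --> g r.
Hypothesis g_le1 : forall r, 0 <= r < 1 -> g r <= 1.
Hypothesis g_lim : g (radius j) @[j --> \oo] --> (1 : R).

Lemma sqdist_ge0 N r s : 0 <= sqdist N r s.
Proof. by apply: sumr_ge0 => n _; exact: nsq_ge0. Qed.

Lemma energy_nondecreasing r s : 0 <= r -> r <= s -> s < 1 -> E r <= E s.
Proof.
move=> r0; rewrite le_eqVlt => /predU1P[->//|rs] s1.
have := le_trans (sqdist_ge0 0 r s) (sqdist_energy 0 r0 (ltW rs) s1).
by rewrite pmulr_rge0 ?subr_gt0// subr_ge0.
Qed.

Lemma energy_bound_ge0 : 0 <= C.
Proof.
have := le_trans (E_ge0 _) (energy_dyadic (leqnn J)).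
by rewrite radius_ge0 radius_lt1 => /(_ isT); rewrite pmulr_lge0// exprn_gt0.
Qed.

(** The energy being nondecreasing, its bound at the next dyadic radius controls the
    whole step. *)
Lemma sqdist_dyadic_step N j s : (J <= j)%N -> radius j <= s <= radius j.+1 ->
  sqdist N (radius j) s <= 2 * C * 2^-1 ^+ j.
Proof.
move=> Jj /andP[js sj]; have s1 := le_lt_trans sj (radius_lt1 _).
apply: le_trans (sqdist_energy N (radius_ge0 j) js s1) _.
have Ej : 0 <= E (radius j) by rewrite E_ge0// radius_ge0 radius_lt1.
have Es : E s <= 2 * C * 2 ^+ j.
  apply: le_trans (energy_nondecreasing _ sj (radius_lt1 _)) _.
    exact: le_trans (radius_ge0 _) js.
  apply: le_trans (energy_dyadic _) _; first exact: leqW.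
  by rewrite exprS; have := energy_bound_ge0; lra.
have srj : s - radius j <= 4^-1 ^+ j.
  by rewrite /radius; move: (4^-1 ^+ j) => q; lra.
apply: (@le_trans _ _ (4^-1 ^+ j * (2 * C * 2 ^+ j))).
  apply: ler_pM => //; [by rewrite subr_ge0| |by lra].
  by rewrite subr_ge0; apply: energy_nondecreasing => //; exact: radius_ge0.
rewrite mulrCA -exprMn (_ : 4^-1 * 2 = 2^-1 :> R)//.
by field.
Qed.

(** Induction on the number of dyadic steps.  The first step is split off with the
    weights of [nsqD_young], and the bound is reproduced because it halves with j. *)
Lemma sqdist_dyadic N k j s : (J <= j)%N -> radius j <= s <= radius (j + k) ->
  sqdist N (radius j) s <= 24 * C * 2^-1 ^+ j.
Proof.
have C0 := energy_bound_ge0.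
elim: k j => [|k IH] j Jj.
  rewrite addn0 => /andP[js sj]; have -> : s = radius j by apply/eqP; rewrite eq_le js sj.
  rewrite big1 => [|n _]; last by rewrite subrr nsq0.
  by rewrite mulr_ge0 ?mulr_ge0 ?exprn_ge0// invr_ge0.
move=> /andP[js sj]; have q0 : 0 < 2^-1 ^+ j :> R by rewrite exprn_gt0.
have [sj1|sj1] := leP s (radius j.+1).
  apply: le_trans (sqdist_dyadic_step N Jj _) _; first by rewrite js.
  by rewrite ler_pM2r// ler_wpM2r// ler_nat.
have h1 : sqdist N (radius j) (radius j.+1) <= 2 * C * 2^-1 ^+ j.
  by apply: sqdist_dyadic_step => //; rewrite lexx radius_nondecreasing.
have h2 : sqdist N (radius j.+1) s <= 24 * C * 2^-1 ^+ j.+1.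
  by apply: IH; [exact: leqW|rewrite (ltW sj1) addSnnS].
have h3 : sqdist N (radius j) s <=
    3 * sqdist N (radius j) (radius j.+1) + 3 / 2 * sqdist N (radius j.+1) s.
  rewrite !mulr_sumr -big_split /=; apply: ler_sum => n _.
  rewrite (_ : psi n (radius j) - psi n s = (psi n (radius j) - psi n (radius j.+1)) +
      (psi n (radius j.+1) - psi n s)); last by ring.
  (* t = 2 makes the recursion 3 * (2 C) + 3/2 * (24 C / 2) = 24 C close up *)
  by have := nsqD_young (psi n (radius j) - psi n (radius j.+1))
    (psi n (radius j.+1) - psi n s) (ltr0n R 2); lra.
by apply: le_trans h3 _; move: h2; rewrite exprS; lra.
Qed.

Lemma sqdist_le N j s : (J <= j)%N -> radius j <= s < 1 ->
  sqdist N (radius j) s <= 24 * C * 2^-1 ^+ j.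
Proof.
move=> Jj /andP[js s1]; have [k sk] := exists_radius_gt s1.
apply: (@sqdist_dyadic N k j s Jj); rewrite js /=; apply: le_trans (ltW sk) _.
by apply: radius_nondecreasing; rewrite leq_addl.
Qed.

Lemma term_sqdist_le n j s : P n -> (J <= j)%N -> radius j <= s < 1 ->
  nsq (psi n (radius j) - psi n s) <= 24 * C * 2^-1 ^+ j.
Proof.
move=> Pn Jj js; apply: le_trans (sqdist_le n.+1 Jj js).
rewrite big_mkcond big_nat_recr//= Pn lerDr.
by apply: sumr_ge0 => k _; case: ifP => // _; exact: nsq_ge0.
Qed.

Lemma cvg_geometric0 (D : R) : D * 2^-1 ^+ j @[j --> \oo] --> (0 : R).
Proof.
rewrite -[X in _ --> X](mulr0 D); apply: cvgM; first exact: cvg_cst.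
by apply: cvg_expr_lt1; rewrite invr_ge0 ler0n /= invf_lt1// ltr1n.
Qed.

Lemma psi_radius_cvg n : P n -> cvgn (fun j => psi n (radius j)).
Proof.
move=> Pn; apply/cvg_ex.
have : cvgn (fun j => psi n (radius (j + J)%N)).
  apply: (@nsq_cauchy_cvg _ _ (fun j => 24 * C * 2^-1 ^+ j)); first exact: cvg_geometric0.
  move=> j k jk; rewrite -nsqN opprB.
  apply: le_trans (term_sqdist_le Pn (leq_addl _ _) _) _.
    by rewrite radius_nondecreasing ?leq_add2r// radius_lt1.
  rewrite ler_wpM2l ?mulr_ge0 ?energy_bound_ge0//; apply: ler_wiXn2l => //; last exact: leq_addr.
  by rewrite invf_le1// ler1n.
by move=> /cvg_ex[l]; rewrite (cvg_shiftn J (fun j => psi n (radius j))) => ?; exists l.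
Qed.

(* the boundary values, read off along the dyadic radii *)
Let L n := limn (fun j => psi n (radius j)).

Lemma sum_radius_limit_le N j : (J <= j)%N ->
  \sum_(0 <= n < N | P n) nsq (psi n (radius j) - L n) <= 24 * C * 2^-1 ^+ j.
Proof.
move=> Jj.
have cX : sqdist N (radius j) (radius k) @[k --> \oo] -->
    \sum_(0 <= n < N | P n) nsq (psi n (radius j) - L n).
  apply: cvg_big => [|n Pn]; first exact: add_continuous.
  apply: cvg_nsq; apply: cvgB; first exact: cvg_cst.
  exact: psi_radius_cvg.
apply: (ler_cvg_to cX (cvg_cst _)); exists j => // k /= jk.
by apply: sqdist_le => //; rewrite radius_nondecreasing// radius_lt1.
Qed.

Lemma psi_left_cvg n : P n -> psi n r @[r --> (1 : R)^'-] --> L n.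
Proof.
move=> Pn; apply/cvgcP/cvgrPdist_lt => e e0.
have e2 : 0 < e ^+ 2 by rewrite exprn_gt0.
have /cvgrPdist_lt/(_ _ e2)[j0 _ /(_ (maxn j0 J) (leq_maxl _ _))] :=
  @cvg_geometric0 (96 * C).
set j := maxn j0 J; have Jj : (J <= j)%N by exact: leq_maxr.
rewrite sub0r normrN => /(le_lt_trans (ler_norm _)) je.
near=> s.
have js : radius j <= s < 1.
  by apply/andP; split; near: s; [exact: nbhs_left_ge (radius_lt1 j)|exact: nbhs_left_lt].
rewrite sub0r normrN ger0_norm ?normc_ge0// -(@ltr_pXn2r _ 2) ?nnegrE ?normc_ge0// ?(ltW e0)//.
rewrite nsqE; apply: le_lt_trans je.
have h1 := term_sqdist_le Pn Jj js.
have h2 : nsq (psi n (radius j) - L n) <= 24 * C * 2^-1 ^+ j.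
  apply: le_trans (sum_radius_limit_le n.+1 Jj).
  rewrite big_mkcond big_nat_recr//= Pn lerDr.
  by apply: sumr_ge0 => k _; case: ifP => // _; exact: nsq_ge0.
rewrite (_ : psi n s - L n = (psi n (radius j) - L n) + (psi n s - psi n (radius j))); last first.
  by ring.
apply: le_trans (nsqD_le _ _) _; rewrite -[nsq (psi n s - _)]nsqN opprB; lra.
Unshelve. all: by end_near.
Qed.

Let S N := \sum_(0 <= n < N | P n) nsq (L n).

Lemma limit_sum_nondecreasing : {homo S : N k / (N <= k)%N >-> N <= k}.
Proof.
move=> n k nk; rewrite /S [leRHS](big_cat_nat (leq0n n) nk)//= lerDl.
by apply: sumr_ge0 => j _; exact: nsq_ge0.
Qed.

Lemma limit_sum_le1 N : S N <= 1.
Proof.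
have cS : \sum_(0 <= n < N | P n) nsq (psi n (radius j)) @[j --> \oo] --> S N.
  apply: cvg_big => [|n Pn]; first exact: add_continuous.
  by apply: cvg_nsq; exact: psi_radius_cvg.
apply: (ler_cvg_to cS (cvg_cst _)); apply: nearW => j.
have r01 : 0 <= radius j < 1 by rewrite radius_ge0 radius_lt1.
apply: le_trans (g_le1 r01); rewrite -(cvg_lim _ (g_cvg r01))//.
apply: nondecreasing_cvgn_le; last exact: cvgP (g_cvg r01).
move=> n k nk; rewrite [leRHS](big_cat_nat (leq0n n) nk)//= lerDl.
by apply: sumr_ge0 => i _; exact: nsq_ge0.
Qed.

(** The lower bound passes first to infinitely many terms at a fixed radius, where
    the sum is known, and only then to the boundary. *)
Lemma limit_sum_cvg1 : S N @[N --> \oo] --> (1 : R).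
Proof.
have Scv : cvgn S.
  apply: nondecreasing_is_cvgn; first exact: limit_sum_nondecreasing.
  by exists 1 => _ [N _ <-]; exact: limit_sum_le1.
suff -> : (1 : R) = limn S by [].
apply/eqP; rewrite eq_le; apply/andP; split; last first.
  by apply: limr_le => //; apply: nearW; exact: limit_sum_le1.
have lim0 : 0 <= limn S.
  apply: limr_ge => //; apply: nearW => N; apply: sumr_ge0 => n _; exact: nsq_ge0.
have key (t : R) : 0 < t -> 1 <= (1 + t) * limn S.
  move=> t0.
  have cr : (1 + t) * limn S + (1 + t^-1) * (24 * C * 2^-1 ^+ j) @[j --> \oo] -->
      (1 + t) * limn S + (1 + t^-1) * 0.
    exact: cvgD (cvg_cst _) (cvgM (cvg_cst _) (@cvg_geometric0 (24 * C))).
  rewrite -[leRHS]addr0 -[X in _ + X](mulr0 (1 + t^-1)).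
  apply: (ler_cvg_to g_lim cr); exists J => // j /= Jj.
  have r01 : 0 <= radius j < 1 by rewrite radius_ge0 radius_lt1.
  apply: (ler_cvg_to (g_cvg r01) (cvg_cst _)); apply: nearW => N.
  have tV : 0 <= 1 + t^-1 by rewrite addr_ge0// invr_ge0 ltW.
  have t1 : 0 <= 1 + t by rewrite addr_ge0// ltW.
  apply: (@le_trans _ _ ((1 + t) * S N +
      (1 + t^-1) * \sum_(0 <= n < N | P n) nsq (psi n (radius j) - L n))).
    rewrite !mulr_sumr -big_split /=; apply: ler_sum => n _.
    apply: le_trans (nsqD_young _ _ t0); rewrite le_eqVlt; apply/orP; left; apply/eqP.
    by congr nsq; rewrite addrC subrK.
  apply: lerD; apply: ler_wpM2l => //; last exact: sum_radius_limit_le.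
  by apply: nondecreasing_cvgn_le => //; exact: limit_sum_nondecreasing.
have L1 : limn S <= 1 by apply: limr_le => //; apply: nearW; exact: limit_sum_le1.
rewrite leNgt; apply/negP => S1.
have t0 : 0 < (1 - limn S) / 2 by rewrite divr_gt0// subr_gt0.
by have := key _ t0; nra.
Qed.

(** Square increments along the radius dominated by increments of an energy [E] of
    the order of (distance to the boundary)^(-1/2) force convergence in l^2; the
    square norm of the limit is then the limit of the square norms [g]. *)
Lemma radial_limits :
  (forall n, P n -> cvg (psi n r @[r --> (1 : R)^'-])) /\
  (\sum_(0 <= n <oo | P n) (normc (lim (psi n r @[r --> (1 : R)^'-])) ^+ 2)%:E = 1)%E.
Proof.
split => [n Pn|]; first by apply/cvg_ex; exists (L n); exact: psi_left_cvg.
apply: cvg_lim => //.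
rewrite (_ : (fun N => _) = EFin \o S); first last.
  apply/funext => N; rewrite /= /S -sumEFin; apply: eq_bigr => n Pn.
  by rewrite nsqE; congr (nsq _)%:E; apply: cvg_lim => //; exact: psi_left_cvg.
by apply: cvg_EFin; [exact: nearW|exact: limit_sum_cvg1].
Qed.

End energy.

(** * Boundary points off the zero set of the polynomial *)

Section boundary_point.
Local Open Scope ring_scope.
Variables (R : realType) (d : nat).
Implicit Types (z : d.-tuple R[i]) (c : multinom d -> R[i]).

Lemma sum_inv_sqr_le n : \sum_(k < n) (k.+1%:R^-1) ^+ 2 <= 2 :> R.
Proof.
case: n => [|n]; first by rewrite big_ord0.
suff : \sum_(k < n.+1) (k.+1%:R^-1) ^+ 2 <= 2 - n.+1%:R^-1 :> R.
  by move=> /le_trans; apply; rewrite lerBlDr lerDl invr_ge0.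
elim: n => [|n IH]; first by rewrite big_ord1 invr1; lra.
rewrite big_ord_recr /=.
have n1 : n.+2%:R = n.+1%:R + 1 :> R by rewrite -[in LHS]addn1 natrD.
rewrite n1; have : 0 < n.+1%:R :> R by [].
move: IH; move: (\sum_(k < n.+1) _) (n.+1%:R : R) => S x IH x0.
have x0' : x != 0 by rewrite gt_eqF.
have x1 : x + 1 != 0 by rewrite gt_eqF// ltr_wpDr.
have : x^-1 - (x + 1)^-1 - (x + 1)^-1 ^+ 2 = x^-1 * (x + 1)^-1 ^+ 2.
  by field; rewrite x0' x1.
have : 0 <= x^-1 * (x + 1)^-1 ^+ 2 by rewrite mulr_ge0 ?sqr_ge0// invr_ge0 ltW.
lra.
Qed.

(** Arithmetic-geometric mean with weights 2^-j and 2^j: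
    2 x^k/(k + 1) <= 2^-j x^(2k) + 2^j/(k + 1)^2.  Both resulting sums are O(2^j)
    because 1 - x >= 4^-j. *)
Lemma sum_inv_le (x : R) j n : 0 <= x <= radius R j ->
  \sum_(k < n) k.+1%:R^-1 * x ^+ k <= 3 / 2 * 2 ^+ j.
Proof.
move=> /andP[x0 xr]; have x1 : x < 1 by exact: le_lt_trans xr (radius_lt1 _ _).
pose p : R := 2 ^+ j; have p0 : 0 < p by rewrite exprn_gt0.
have pV0 : 0 < p^-1 by rewrite invr_gt0.
apply: (@le_trans _ _ (\sum_(k < n) 2^-1 * (p^-1 * x ^+ k + p * (k.+1%:R^-1) ^+ 2))).
  apply: ler_sum => k _; set a := k.+1%:R^-1; set b := x ^+ k.
  have b0 : 0 <= b by rewrite exprn_ge0.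
  have b1 : b <= 1 by rewrite exprn_ile1// ltW.
  have : p^-1 * b ^+ 2 <= p^-1 * b by rewrite ler_wpM2l ?(ltW pV0)// expr2 ler_piMl.
  have : p * (p^-1 * b - a) ^+ 2 = p^-1 * b ^+ 2 - 2 * (a * b) + p * a ^+ 2.
    by field; rewrite gt_eqF.
  have : 0 <= p * (p^-1 * b - a) ^+ 2 by rewrite mulr_ge0 ?sqr_ge0// ltW.
  lra.
rewrite -mulr_sumr big_split /= -!mulr_sumr.
have h1 : p^-1 * \sum_(k < n) x ^+ k <= p.
  rewrite mulrC ler_pdivrMr// -expr2; apply: le_trans (geometric_le _ _) _; first by rewrite x0.
  have x1' : 0 < 1 - x by rewrite subr_gt0.
  rewrite -[leLHS]mul1r ler_pdivrMr//.
  have : 4^-1 ^+ j <= 1 - x by move: xr; rewrite /radius; move: (4^-1 ^+ j) => q; lra.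
  move=> /(ler_wpM2l (ltW (exprn_gt0 2 p0))); apply: le_trans.
  rewrite /p -exprM mulnC exprM -exprMn (_ : 2 ^+ 2 * 4^-1 = 1 :> R) ?expr1n//.
  by field.
have h2 : p * \sum_(k < n) (k.+1%:R^-1) ^+ 2 <= p * 2.
  by rewrite ler_wpM2l ?sum_inv_sqr_le// ltW.
by rewrite -/p; lra.
Qed.

Lemma monom_tscale r z m : monom (tnth (tscale r z)) m = (r ^+ mdeg m)%:C * monom (tnth z) m.
Proof.
rewrite /monom mdegE -prodrXr rmorph_prod -big_split; apply: eq_bigr => i _ /=.
by rewrite tnth_tscale exprMn rmorphXn.
Qed.

Lemma cvg_realC (x : nat -> R) (l : R) : x n @[n --> \oo] --> l ->
  (x n)%:C @[n --> \oo] --> (l%:C : R[i]).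
Proof. by move=> xl; apply/cvg_complexP; split => //=; exact: cvg_cst. Qed.

Lemma peval_radius_cvg N c z :
  peval N c (tscale (radius R j) z) @[j --> \oo] --> peval N c z.
Proof.
rewrite /peval /psum; apply: cvg_big => [|m _]; first exact: add_continuous.
under eq_fun do rewrite monom_tscale.
have rk k : radius R j ^+ k @[j --> \oo] --> (1 : R).
  rewrite -[X in _ --> X](expr1n R k).
  by apply: (continuous_cvg _ (@exprn_continuous R k 1)); exact: radius_cvg.
have := cvgM (cvg_cst (c m)) (cvgM (cvg_realC (rk (mdeg m))) (cvg_cst (monom (tnth z) m))).
by rewrite rmorph1 mul1r; apply.
Qed.

(** The energy inequality applies because the square distance of the kernels to M is
    O(2^j) at the radii 1 - 4^-j, where p stays away from 0. *)
Lemma radial_limits_at M len (phi : nat -> d.-tuple R[i] -> R[i]) N c z :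
  closed_submodule M ->
  (forall n, in_range len n -> multiplier (phi n)) ->
  strong_sum len (fun n => mult_op (phi n) \o adjoint (mult_op (phi n))) (orth_proj M) ->
  M c -> (forall m, (N <= mdeg m)%N -> c m = 0) ->
  unit_sphere z -> peval N c z != 0 ->
  (forall n, in_range len n -> cvg (radial (phi n) z r @[r --> 1^'-])) /\
  (\sum_(0 <= n <oo | in_range len n) (normc (boundary (phi n) z) ^+ 2)%:E = 1)%E.
Proof.
move=> hM hphi hsum Mc cN zS cz.
have z1 : sqabs z = 1.
  move: zS; rewrite /unit_sphere /tnorm /=; under eq_bigr do rewrite nsqE.
  by move=> /(congr1 (fun x => x ^+ 2)); rewrite sqr_sqrtr ?sqabs_ge0// expr1n.
have b r : 0 <= r < 1 -> unit_ball (tscale r z) by exact: unit_ball_tscale.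
have D_ge0 r : 0 <= r < 1 -> 0 <= radial_rest M z r.
  by move=> /b rb; apply: nrm2_ge0; exact: H2_kern_rest.
have rad01 j : 0 <= radius R j < 1 by rewrite radius_ge0 radius_lt1.
have [J [C C0 DC]] : exists J, exists2 C, 0 <= C &
    forall j, (J <= j)%N -> radial_rest M z (radius R j) <= C * 2 ^+ j.
  have [C C0 HC] := kern_rest_le hM Mc cN.
  pose e := nsq (peval N c z).
  have e0 : 0 < e.
    rewrite lt_neqAle nsq_ge0 andbT eq_sym; apply: contra cz => /eqP /nsq_eq0 ->.
    by [].
  have e2 : 0 < e / 2 by rewrite divr_gt0.
  have /cvgrPdist_lt/(_ _ e2)[J _ HJ] := cvg_nsq (@peval_radius_cvg N c z).
  exists J; exists (C * (1 + d%:R * (3 / 2)) / (e / 2)).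
    by rewrite divr_ge0// ?(ltW e2)// mulr_ge0// addr_ge0// mulr_ge0.
  move=> j Jj; have /= := HJ j Jj; rewrite -/e => /(le_lt_trans (ler_norm _)) pe.
  have {pe}pe : e / 2 <= nsq (peval N c (tscale (radius R j) z)) by lra.
  have D0 := D_ge0 _ (rad01 j).
  have defle : eigen_defect (tscale (radius R j) z) <= (1 + d%:R * (3 / 2)) * 2 ^+ j.
    apply: le_trans (@eigen_defect_le _ _ _ (3 / 2 * 2 ^+ j) (b _ (rad01 j)) _) _.
      move=> n; apply: sum_inv_le; rewrite sqabs_ge0 sqabs_tscale// expr2.
      by rewrite ler_piMl// ?radius_ge0// ltW// radius_lt1.
    have p1 : 1 <= 2 ^+ j :> R by rewrite exprn_ege1// ler1n.
    by move: p1; move: (2 ^+ j) (d%:R : R) => p x p1; lra.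
  rewrite mulrAC ler_pdivlMr// mulrC.
  apply: le_trans (ler_wpM2r D0 pe) _.
  apply: le_trans (HC _ (b _ (rad01 j))) _.
  by rewrite -mulrA ler_wpM2l.
have := @radial_limits R (in_range len) (fun n r => phi n (tscale r z))
  (fun r => r * radial_rest M z r) (fun r => 1 - (1 - r ^+ 2) * radial_rest M z r) C J.
apply.
- by move=> n r s r0 rs s1; apply: sum_nsqB_le.
- by move=> r r01; rewrite mulr_ge0 ?D_ge0//; case/andP: r01.
- move=> j Jj; apply: le_trans (DC j Jj); rewrite ler_piMl// ?D_ge0//.
  exact: ltW (radius_lt1 _ _).
- by move=> r r01; exact: sum_nsq_cvg.
- move=> r /[dup] r01 /andP[r0 r1]; rewrite gerBl mulr_ge0 ?D_ge0//.
  by rewrite subr_ge0 exprn_ile1// ltW.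
rewrite -[X in _ --> X]subr0; apply: cvgB; first exact: cvg_cst.
apply: (@squeeze_cvgr _ _ _ _ (fun=> 0) (fun j => 2 * C * 2^-1 ^+ j)); last exact: cvg_geometric0.
  exists J => // j /= Jj; have /andP[r0 r1] := rad01 j.
  have h0 : 0 <= 1 - radius R j ^+ 2 by rewrite subr_ge0 exprn_ile1// ltW.
  rewrite (mulr_ge0 h0 (D_ge0 _ (rad01 j))) /=.
  have h : 1 - radius R j ^+ 2 <= 2 * 4^-1 ^+ j.
    rewrite /radius; move: (sqr_ge0 (4^-1 ^+ j : R)); move: (4^-1 ^+ j) => q; lra.
  apply: le_trans (ler_pM h0 (D_ge0 _ (rad01 j)) h (DC j Jj)) _.
  rewrite mulrACA -exprMn (_ : 4^-1 * 2 = 2^-1 :> R)//.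
  by field.
exact: cvg_cst.
Qed.

End boundary_point.

(** * Null sets of real polynomials *)

Section null_sets.
Local Open Scope ring_scope.
Variable R : realType.

(** Fubini for null sets, allowing a null set [B] of exceptional slices. *)
Lemma prod_null d1 d2 (T1 : measurableType d1) (T2 : measurableType d2)
    (m1 : {sigma_finite_measure set T1 -> \bar R})
    (m2 : {sigma_finite_measure set T2 -> \bar R}) (Z : set (T1 * T2)) (B : set T1) :
  measurable Z -> measurable B -> m1 B = 0%E ->
  (forall x, ~ B x -> m2 (xsection Z x) = 0%E) -> prod_sf m1 m2 Z = 0%E.
Proof.
move=> mZ mB B0 sec0; rewrite /prod_sf /product_measure1.
rewrite (ae_eq_integral (cst 0%E)) ?integral0//; first exact: measurable_fun_xsection.
exists B; split => // x /= nx; apply: contrapT => Bx; apply: nx => _.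
exact: sec0.
Qed.

Lemma poly_real_roots_countable (p : {poly R[i]}) (f : R -> R[i]) :
  injective f -> p != 0 -> countable [set x : R | p.[f x] = 0].
Proof.
move=> finj p0; have [r pE] := closed_field_poly_normal p.
have rP y : p.[y] = 0 -> y \in r.
  move=> /eqP; rewrite pE hornerZ mulf_eq0 lead_coef_eq0 (negbTE p0) /=.
  by rewrite -[_ == 0]/(root _ _) root_prod_XsubC.
have fr : finite_set [set x : R | p.[f x] = 0].
  apply: (@sub_finite_set _ _ (f @^-1` [set` r])); first by move=> x /= /rP.
  by apply: finite_preimage; [move=> x y _ _ /finj|exact: finite_seq].
exact: finite_set_countable.
Qed.

Definition measurable_complex d (T : measurableType d) (F : T -> R[i]) :=
  measurable_fun [set: T] (fun t => complex.Re (F t)) /\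
  measurable_fun [set: T] (fun t => complex.Im (F t)).

Lemma measurable_complex_zero d (T : measurableType d) (F : T -> R[i]) :
  measurable_complex F -> measurable [set t | F t = 0].
Proof.
move=> [mr mi].
rewrite (_ : [set t | _] = (fun t => complex.Re (F t)) @^-1` [set 0] `&`
    (fun t => complex.Im (F t)) @^-1` [set 0]).
  apply: measurableI.
    by rewrite -[X in measurable X]setTI; apply: mr => //; exact: measurable_set1.
  by rewrite -[X in measurable X]setTI; apply: mi => //; exact: measurable_set1.
apply/seteqP; split => t /=; first by move=> ->.
by case: (F t) => a b /= [-> ->].
Qed.

Lemma measurable_complexD d (T : measurableType d) (F G : T -> R[i]) :
  measurable_complex F -> measurable_complex G -> measurable_complex (fun t => F t + G t).
Proof.
move=> [Fr Fi] [Gr Gi]; split.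
  rewrite (_ : (fun t => _) = (fun t => complex.Re (F t)) \+ (fun t => complex.Re (G t))).
    exact: measurable_funD.
  by apply/funext => t /=; case: (F t) (G t) => a b [].
rewrite (_ : (fun t => _) = (fun t => complex.Im (F t)) \+ (fun t => complex.Im (G t))).
  exact: measurable_funD.
by apply/funext => t /=; case: (F t) (G t) => a b [].
Qed.

Lemma measurable_complexM d (T : measurableType d) (F G : T -> R[i]) :
  measurable_complex F -> measurable_complex G -> measurable_complex (fun t => F t * G t).
Proof.
move=> [Fr Fi] [Gr Gi]; split.
  rewrite (_ : (fun t => _) =
      ((fun t => complex.Re (F t)) \* (fun t => complex.Re (G t))) \-
      ((fun t => complex.Im (F t)) \* (fun t => complex.Im (G t)))).
    by apply: measurable_funB; exact: measurable_funM.
  by apply/funext => t /=; case: (F t) (G t) => a b [].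
rewrite (_ : (fun t => _) =
    ((fun t => complex.Re (F t)) \* (fun t => complex.Im (G t))) \+
    ((fun t => complex.Im (F t)) \* (fun t => complex.Re (G t)))).
  by apply: measurable_funD; exact: measurable_funM.
by apply/funext => t /=; case: (F t) (G t) => a b [].
Qed.

Lemma measurable_complex_comp d d' (T : measurableType d) (T' : measurableType d')
    (F : T -> R[i]) (h : T' -> T) :
  measurable_complex F -> measurable_fun [set: T'] h -> measurable_complex (F \o h).
Proof.
by move=> [Fr Fi] mh; split; [exact: (measurableT_comp Fr mh)|exact: (measurableT_comp Fi mh)].
Qed.

Definition bipoly (f : R[i] -> R[i]) :=
  (forall b, exists p : {poly R[i]}, forall a, f (a +i* b) = p.[a%:C]) /\
  (forall a, exists p : {poly R[i]}, forall b, f (a +i* b) = p.[b%:C]).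

(** Polynomial in each real coordinate when all others are fixed.  The
    condition is stable under sums and products and is inherited by slices, which is what
    an induction with Fubini asks for. *)
Fixpoint seppoly n : (n.-tuple R[i] -> R[i]) -> Prop :=
  if n is m.+1 return (n.-tuple R[i] -> R[i]) -> Prop then fun F =>
    (forall x, seppoly (fun t => F (tcons (x, t)))) /\
    (forall t, bipoly (fun x => F (tcons (x, t))))
  else fun=> True.

Lemma bipoly_cst c : bipoly (fun=> c).
Proof. by split => a; exists c%:P => b; rewrite hornerC. Qed.

Lemma bipolyD f g : bipoly f -> bipoly g -> bipoly (fun x => f x + g x).
Proof.
move=> [f1 f2] [g1 g2]; split => a.
  by have [p pE] := f1 a; have [q qE] := g1 a; exists (p + q) => b; rewrite hornerD pE qE.
by have [p pE] := f2 a; have [q qE] := g2 a; exists (p + q) => b; rewrite hornerD pE qE.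
Qed.

Lemma bipolyM f g : bipoly f -> bipoly g -> bipoly (fun x => f x * g x).
Proof.
move=> [f1 f2] [g1 g2]; split => a.
  by have [p pE] := f1 a; have [q qE] := g1 a; exists (p * q) => b; rewrite hornerM pE qE.
by have [p pE] := f2 a; have [q qE] := g2 a; exists (p * q) => b; rewrite hornerM pE qE.
Qed.

Lemma bipoly_id : bipoly id.
Proof.
split => a.
  exists ('X + (0 +i* a)%:P) => b; rewrite hornerD hornerX hornerC.
  by apply: complex_eqP => /=; ring.
exists ((0 +i* 1) *: 'X + (a%:C)%:P) => b; rewrite hornerD hornerZ hornerX hornerC.
by apply: complex_eqP => /=; ring.
Qed.

Lemma bipoly_conj : bipoly (fun x => x^*).
Proof.
split => a.
  exists ('X + (0 +i* - a)%:P) => b; rewrite hornerD hornerX hornerC conjE.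
  by apply: complex_eqP => /=; ring.
exists ((0 +i* - 1) *: 'X + (a%:C)%:P) => b; rewrite hornerD hornerZ hornerX hornerC conjE.
by apply: complex_eqP => /=; ring.
Qed.

Lemma seppoly_cst n c : seppoly (fun _ : n.-tuple R[i] => c).
Proof. by elim: n => //= n IH; split => // t; exact: bipoly_cst. Qed.

Lemma seppolyD n (F G : n.-tuple R[i] -> R[i]) :
  seppoly F -> seppoly G -> seppoly (fun t => F t + G t).
Proof.
elim: n F G => //= n IH F G [F1 F2] [G1 G2].
by split => [x|t]; [exact: IH|exact: bipolyD].
Qed.

Lemma seppolyM n (F G : n.-tuple R[i] -> R[i]) :
  seppoly F -> seppoly G -> seppoly (fun t => F t * G t).
Proof.
elim: n F G => //= n IH F G [F1 F2] [G1 G2].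
by split => [x|t]; [exact: IH|exact: bipolyM].
Qed.

Lemma seppoly_coord n (f : R[i] -> R[i]) (i : 'I_n) : bipoly f ->
  seppoly (fun t => f (tnth t i)).
Proof.
move=> fb; elim: n i => [[]//|n IH] i /=; have [j ->|->] := unliftP ord0 i.
  have E x t : tnth (tcons (x, t)) (lift ord0 j) = tnth t j by exact: tnthS.
  split => [x|t].
    by rewrite (_ : (fun t => _) = (fun t => f (tnth t j)))//; apply/funext => t; rewrite E.
  rewrite (_ : (fun x => _) = (fun=> f (tnth t j))); first exact: bipoly_cst.
  by apply/funext => x; rewrite E.
split => [x|t].
  rewrite (_ : (fun t => _) = (fun=> f x)); first exact: seppoly_cst.
  by apply/funext => t; rewrite [tnth _ _]tnth0.
rewrite (_ : (fun x => _) = f); first exact: fb.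
by apply/funext => x; rewrite [tnth _ _]tnth0.
Qed.

Lemma bipoly_null (f : R[i] -> R[i]) x0 : measurable_complex f -> bipoly f -> f x0 != 0 ->
  lebesgue_C R [set x | f x = 0] = 0%E.
Proof.
move=> mf [f1 f2] fx0; rewrite /lebesgue_C /= /push_iso /pushforward.
have injC : injective (fun x : R => x%:C : R[i]) by move=> x y [].
have [p pE] := f1 (complex.Im x0).
have p0 : p != 0.
  apply: contra fx0 => /eqP p0; have := pE (complex.Re x0); rewrite p0 horner0.
  by case: (x0) => a b /= ->.
have cB := poly_real_roots_countable injC p0.
apply: (@prod_null _ _ _ _ lebesgue_measure lebesgue_measure _ [set a : R | p.[a%:C] = 0]).
- by have := @measurable_of_ReIm R measurableT _ (measurable_complex_zero mf); rewrite setTI.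
- exact: countable_measurable.
- exact: countable_lebesgue_measure0.
move=> a /= pa; have [q qE] := f2 a.
have q0 : q != 0.
  apply/eqP => q0; apply: pa; rewrite -pE qE q0 horner0//.
rewrite (_ : xsection _ _ = [set b | q.[b%:C] = 0]).
  exact: countable_lebesgue_measure0 (poly_real_roots_countable injC q0).
by apply/seteqP; split => b; rewrite /xsection /= inE /= -qE.
Qed.

(** Fubini and induction on the number of coordinates: the slices on which [F]
    vanishes identically lie over the zeros of a nonzero function of one
    coordinate. *)
Lemma seppoly_null n (F : n.-tuple R[i] -> R[i]) t0 : measurable_complex F -> seppoly F ->
  F t0 != 0 -> lebesgue_Cn R n [set t | F t = 0] = 0%E.
Proof.
elim: n F t0 => [|n IH] F t0 mF.
  move=> _ F0; rewrite /= diracE memNset//= => F0'.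
  by move: F0; rewrite (tuple0 t0) F0' eqxx.
move=> [F1 F2] F0; rewrite /= /push_iso /pushforward.
case/tupleP: t0 F0 => x0 t1; rewrite -[F _]/(F (tcons (x0, t1))) => F0.
have m1 : measurable_complex (fun x => F (tcons (x, t1))).
  apply: (measurable_complex_comp mF (h := fun x => tcons (x, t1))).
  by apply: (measurableT_comp (@measurable_tcons R n)); exact: measurable_fun_pair.
apply: (@prod_null _ _ _ _ _ _ _ [set x | F (tcons (x, t1)) = 0]).
- by have := @measurable_tcons R n measurableT _ (measurable_complex_zero mF); rewrite setTI.
- exact: measurable_complex_zero.
- exact: bipoly_null m1 (F2 t1) F0.
move=> x /= /eqP Fx.
rewrite (_ : xsection _ _ = [set t | F (tcons (x, t)) = 0]).
  apply: (IH (fun t => F (tcons (x, t))) t1 _ (F1 x) Fx).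
  apply: (measurable_complex_comp mF (h := fun t => tcons (x, t))).
  by apply: (measurableT_comp (@measurable_tcons R n)); exact: measurable_fun_pair.
by apply/seteqP; split => t; rewrite /xsection /= inE.
Qed.

End null_sets.

(** * The cone over the zeros of a polynomial on the sphere *)

Section zero_cone.
Local Open Scope ring_scope.
Variables (R : realType) (d : nat).
Implicit Types (z w : d.-tuple R[i]) (F G : d.-tuple R[i] -> R[i]).

Definition real_poly F := measurable_complex F /\ seppoly F.

Lemma real_polyD F G : real_poly F -> real_poly G -> real_poly (fun z => F z + G z).
Proof. by move=> [F1 F2] [G1 G2]; split; [exact: measurable_complexD|exact: seppolyD]. Qed.

Lemma real_polyM F G : real_poly F -> real_poly G -> real_poly (fun z => F z * G z).
Proof. by move=> [F1 F2] [G1 G2]; split; [exact: measurable_complexM|exact: seppolyM]. Qed.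

Lemma real_poly_cst x : real_poly (fun=> x).
Proof.
by split; [split; exact: measurable_cst|exact: seppoly_cst].
Qed.

Lemma real_poly_coord i : real_poly (fun z => tnth z i).
Proof.
split; last exact: seppoly_coord (@bipoly_id R).
by split; apply: measurableT_comp (measurable_tnth i);
  [exact: measurable_Re|exact: measurable_Im].
Qed.

Lemma real_poly_conj i : real_poly (fun z => (tnth z i)^*).
Proof.
split; last exact: seppoly_coord (@bipoly_conj R).
have [[mr mi] _] := real_poly_coord i; split.
  by rewrite (_ : (fun z => _) = (fun z => complex.Re (tnth z i)))//;
    apply/funext => z; rewrite conjE; case: (tnth z i).
rewrite (_ : (fun z => _) = \- (fun z => complex.Im (tnth z i))).
  exact: measurableT_comp mi.
by apply/funext => z /=; rewrite conjE; case: (tnth z i).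
Qed.

Lemma real_poly_sum (I : Type) (r : seq I) (P : pred I) (F : I -> d.-tuple R[i] -> R[i]) :
  (forall k, real_poly (F k)) -> real_poly (fun z => \sum_(k <- r | P k) F k z).
Proof.
move=> FP; elim: r => [|k r IH].
  by under eq_fun do rewrite big_nil; exact: real_poly_cst.
under eq_fun do rewrite big_cons; case: (P k) => //.
exact: real_polyD.
Qed.

Lemma real_poly_prod (I : Type) (r : seq I) (P : pred I) (F : I -> d.-tuple R[i] -> R[i]) :
  (forall k, real_poly (F k)) -> real_poly (fun z => \prod_(k <- r | P k) F k z).
Proof.
move=> FP; elim: r => [|k r IH].
  by under eq_fun do rewrite big_nil; exact: real_poly_cst.
under eq_fun do rewrite big_cons; case: (P k) => //.
exact: real_polyM.
Qed.

Lemma real_polyX F n : real_poly F -> real_poly (fun z => F z ^+ n).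
Proof.
move=> FP; elim: n => [|n IH].
  by under eq_fun do rewrite expr0; exact: real_poly_cst.
by under eq_fun do rewrite exprS; exact: real_polyM.
Qed.

Lemma real_poly_sqabs : real_poly (fun z => (sqabs z)%:C).
Proof.
rewrite (_ : (fun z => _) = fun z => \sum_(i < d) tnth z i * (tnth z i)^*).
  apply: real_poly_sum => i.
  by apply: real_polyM; [exact: real_poly_coord|exact: real_poly_conj].
apply/funext => z; rewrite /sqabs rmorph_sum /=.
by apply: eq_bigr => i _; rewrite mulcJ.
Qed.

Lemma real_poly_monom m : real_poly (fun z => monom (tnth z) m).
Proof.
by apply: real_poly_prod => i; apply: real_polyX; exact: real_poly_coord.
Qed.

Variables (N : nat) (c : multinom d -> R[i]).

Lemma real_poly_peval : real_poly (peval N c).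
Proof.
apply: real_poly_sum => m.
by apply: real_polyM; [exact: real_poly_cst|exact: real_poly_monom].
Qed.

(** The terms of sum_m c_m s^(N - |m|) z^m in which the exponent of s is odd (or even),
    with s^2 replaced by |z|^2 and a remaining factor s omitted. *)
Definition parity_part b z : R[i] :=
  \sum_(m : bmultinom d N | odd (N - mdeg m) == b)
    c m * (sqabs z)%:C ^+ (N - mdeg m)./2 * monom (tnth z) m.

(** Up to sign this is |z|^(2N) p(z/|z|) p(-z/|z|), written without |z|. *)
Definition cone_poly z : R[i] :=
  parity_part false z ^+ 2 + (-1) * (sqabs z)%:C * parity_part true z ^+ 2.

Lemma real_poly_cone : real_poly cone_poly.
Proof.
have pp b : real_poly (parity_part b).
  apply: real_poly_sum => m; apply: real_polyM; last exact: real_poly_monom.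
  by apply: real_polyM; [exact: real_poly_cst|apply: real_polyX; exact: real_poly_sqabs].
apply: real_polyD; first exact: real_polyX.
apply: real_polyM; last exact: real_polyX.
by apply: real_polyM; [exact: real_poly_cst|exact: real_poly_sqabs].
Qed.

Definition homogenized (s : R) z : R[i] :=
  \sum_(m : bmultinom d N) c m * s%:C ^+ (N - mdeg m) * monom (tnth z) m.

Lemma homogenized_parity s z : s ^+ 2 = sqabs z ->
  homogenized s z = parity_part false z + s%:C * parity_part true z.
Proof.
move=> s2; rewrite /homogenized (bigID (fun m : bmultinom d N => odd (N - mdeg m) == false)) /=.
congr (_ + _).
  apply: eq_bigr => m /eqP odm; congr (_ * _ * _).
  by rewrite -s2 rmorphXn -exprM mul2n -[in LHS](odd_double_half (N - mdeg m)) odm.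
rewrite /parity_part mulr_sumr; apply: eq_big => [m|m odm]; first by case: odd.
have {}odm : odd (N - mdeg m) by case: odd odm.
rewrite -s2 rmorphXn -exprM mul2n -[in LHS](odd_double_half (N - mdeg m)) odm add1n exprS.
by ring.
Qed.

Lemma cone_polyE s z : s ^+ 2 = sqabs z ->
  cone_poly z = homogenized s z * homogenized (- s) z.
Proof.
move=> s2; rewrite !homogenized_parity ?sqrrN// rmorphN /cone_poly -s2 rmorphXn /=.
by ring.
Qed.

Lemma homogenizedE s z : s != 0 ->
  homogenized s z = s%:C ^+ N * peval N c (tscale s^-1 z).
Proof.
move=> s0; rewrite /homogenized /peval /psum mulr_sumr; apply: eq_bigr => m _.
rewrite monom_tscale mulrCA -mulrA; congr (_ * _); rewrite mulrA; congr (_ * _).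
have mN : (mdeg m <= N)%N by rewrite ltnW// bmdeg.
rewrite -[X in _ = _ ^+ X * _](subnK mN) exprD rmorphXn fmorphV.
rewrite -mulrA -exprMn divff ?expr1n ?mulr1//.
by rewrite fmorph_eq0.
Qed.

Hypothesis cN : forall m, (N <= mdeg m)%N -> c m = 0.

Lemma fun_of_peval z : fun_of c z = peval N c z.
Proof.
apply: cvg_lim => //; apply: cvg_near_cst; exists N => // n /= Nn.
rewrite [RHS](psum_widen _ Nn) (bigID (fun m : bmultinom d n => (mdeg m < N)%N)) /=.
by rewrite [X in _ + X]big1 ?addr0// => m; rewrite -leqNgt => /cN ->; rewrite mul0r.
Qed.

Lemma H2_finite : H2 c.
Proof.
rewrite (_ : c = trunc N c); last first.
  by apply/funext => m; rewrite truncE; case: ltnP => // /cN.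
by apply: H2_sum => b _; apply: H2Z; exact: H2_delta.
Qed.

(** The identity theorem for z_i p rather than p: a nonvanishing value is then taken
    at a point different from the origin. *)
Lemma exists_peval_neq0 (i : 'I_d) : c <> 0 ->
  exists2 z, tnth z i != 0 & peval N c z != 0.
Proof.
move=> c0; apply: contrapT => nz.
have sc0 : shift i c = 0.
  apply: fun_of_inj0; first by apply: H2_shift; exact: H2_finite.
  move=> z zb; rewrite fun_of_shift//; last exact: H2_finite.
  rewrite fun_of_peval; apply/eqP; rewrite mulf_eq0; apply/negPn/negP.
  by rewrite negb_or => /andP[zi pz]; apply: nz; exists z.
by apply: c0; apply/funext => m; rewrite -(shift_up i c m) sc0.
Qed.

Definition cscale (x : R[i]) z : d.-tuple R[i] := [tuple x * tnth z i | i < d].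

Lemma sqabs_cscale x z : sqabs (cscale x z) = nsq x * sqabs z.
Proof.
by rewrite /sqabs mulr_sumr; apply: eq_bigr => i _; rewrite tnth_mktuple nsqM.
Qed.

Lemma tscale_cscale (s : R) x z : tscale s (cscale x z) = cscale (s%:C * x) z.
Proof. by apply: eq_from_tnth => i; rewrite !tnth_mktuple mulrA. Qed.

(** The polynomial t |-> p(t z) in one variable. *)
Definition slice z : {poly R[i]} :=
  \sum_(m : bmultinom d N) (c m * monom (tnth z) m) *: 'X^(mdeg m).

Lemma horner_slice z x : (slice z).[x] = peval N c (cscale x z).
Proof.
rewrite /slice horner_sum; apply: eq_bigr => m _; rewrite hornerZ hornerXn -mulrA.
congr (_ * _); rewrite /monom mdegE -prodrXr -big_split; apply: eq_bigr => i _ /=.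
by rewrite tnth_mktuple exprMn mulrC.
Qed.

(** Rational points of the unit circle: infinitely many, without trigonometry. *)
Definition circle_point (n : nat) : R[i] :=
  ((1 - n%:R ^+ 2) / (1 + n%:R ^+ 2)) +i* (2 * n%:R / (1 + n%:R ^+ 2)).

Lemma circle_den_neq0 (n : nat) : 1 + n%:R ^+ 2 != 0 :> R.
Proof. by rewrite gt_eqF// ltr_wpDr// sqr_ge0. Qed.

Lemma nsq_circle_point n : nsq (circle_point n) = 1.
Proof.
by rewrite /nsq /=; field; have := circle_den_neq0 n.
Qed.

Lemma circle_point_inj : injective circle_point.
Proof.
move=> n k /(congr1 (@complex.Re R)) /=.
have E (j : nat) : (1 - j%:R ^+ 2) / (1 + j%:R ^+ 2) = 2 / (1 + j%:R ^+ 2) - 1 :> R.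
  by field; have := circle_den_neq0 j.
rewrite !E => /addIr /(mulfI _); rewrite pnatr_eq0 => /(_ isT) /invr_inj /addrI /eqP.
by rewrite -!natrX eqr_nat eqn_exp2r// => /eqP.
Qed.

(** On the circle of radius 1/|z| the polynomial t |-> p(t z) has finitely many zeros,
    so some t on it has p(t z) and p(-t z) both nonzero. *)
Lemma cone_poly_neq0 : (0 < d)%N -> c <> 0 -> exists w, cone_poly w != 0.
Proof.
move=> d0 c0; have [z zi pz] := exists_peval_neq0 (Ordinal d0) c0.
have sz : 0 < sqabs z.
  rewrite /sqabs (bigD1 (Ordinal d0)) //= ltr_pwDl//; last first.
    by apply: sumr_ge0 => i _; exact: nsq_ge0.
  rewrite lt_neqAle nsq_ge0 andbT eq_sym; apply: contra zi => /eqP /nsq_eq0 ->.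
  by [].
pose rho : R := (Num.sqrt (sqabs z))^-1.
have rho0 : rho != 0 by rewrite invr_eq0 sqrtr_eq0 -ltNge.
have sl0 : slice z != 0.
  apply: contra pz => /eqP s0; have := horner_slice z 1; rewrite s0 horner0 => e.
  rewrite (_ : z = cscale 1 z) -?e//.
  by apply: eq_from_tnth => i; rewrite tnth_mktuple mul1r.
have [r rE] := closed_field_poly_normal (slice z).
have rP y : (slice z).[y] = 0 -> y \in r.
  move=> /eqP; rewrite rE hornerZ mulf_eq0 lead_coef_eq0 (negbTE sl0) /=.
  by rewrite -[_ == 0]/(root _ _) root_prod_XsubC.
pose L := r ++ map -%R r.
pose v n := rho%:C * circle_point n.
have vinj : injective v.
  by move=> n k /(mulfI _) h; apply: circle_point_inj; apply: h; rewrite fmorph_eq0.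
have [n vL] : exists n, v n \notin L.
  apply: contrapT => nn.
  have sub : {subset map v (iota 0 (size L).+1) <= L}.
    move=> y /mapP[n _ ->]; apply/negPn/negP => vn; apply: nn; by exists n.
  have := uniq_leq_size _ sub; rewrite map_inj_uniq// iota_uniq => /(_ isT).
  by rewrite size_map size_iota ltnn.
exists (cscale (v n) z).
have sq1 : 1 ^+ 2 = sqabs (cscale (v n) z).
  rewrite sqabs_cscale nsqM nsqC nsq_circle_point mulr1 /rho exprVn sqr_sqrtr ?ltW//.
  by rewrite mulVf ?gt_eqF// expr1n.
rewrite (cone_polyE sq1) !homogenizedE ?oppr_eq0 ?oner_eq0//.
rewrite !tscale_cscale -!horner_slice !mulf_neq0 ?expf_neq0 ?fmorph_eq0 ?oppr_eq0 ?oner_eq0//.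
  rewrite invr1 rmorph1 mul1r; apply: contra vL => /eqP /rP vr.
  by rewrite mem_cat vr.
rewrite invrN1 rmorphN rmorph1 mulN1r; apply: contra vL => /eqP /rP vr.
rewrite mem_cat; apply/orP; right; apply/mapP; exists (- v n) => //.
by rewrite opprK.
Qed.

Lemma surface_null : (0 < d)%N -> c <> 0 ->
  {ae @surface_measure R d, forall z, unit_sphere z -> peval N c z != 0}.
Proof.
move=> d0 c0.
have tnormE z : tnorm z ^+ 2 = sqabs z.
  rewrite /tnorm; under eq_bigr do rewrite nsqE.
  by rewrite sqr_sqrtr// sqabs_ge0.
pose A := @unit_sphere R d `&` [set z | peval N c z = 0].
have mA : measurable A.
  apply: measurableI; last by apply: measurable_complex_zero; exact: real_poly_peval.1.
  rewrite (_ : @unit_sphere R d = @tnorm R d @^-1` [set 1])//.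
  rewrite -[X in measurable X]setTI; apply: measurable_tnorm => //.
exists A; split => //; last first.
  move=> z /= nz; apply: contrapT => nA; apply: nz => zS; apply/eqP => pz.
  exact: nA.
have [w Qw] := cone_poly_neq0 d0 c0; have [mQ sQ] := real_poly_cone.
have Q0 := seppoly_null mQ sQ Qw.
suff null : lebesgue_Cn R d (@normalize R d @^-1` A `&` @unit_ball R d) = 0%E.
  exact: (eq_trans (congr1 (fun x => (_ * x)%E) null) (mule0 _)).
apply: (subset_measure0 _ _ _ Q0).
- apply: measurableI; last exact: measurable_unit_ball.
  by have := @measurable_normalize R d measurableT _ mA; rewrite setTI.
- exact: measurable_complex_zero.
move=> x [[/= xS px] _].
have x0 : tnorm x != 0.
  apply/eqP => x0; move: xS; rewrite /unit_sphere /= => xS.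
  have : tnorm (normalize x) ^+ 2 = 0.
    rewrite tnormE /normalize x0 invr0 /sqabs big1// => i _.
    by rewrite tnth_mktuple mul0r nsq0.
  by rewrite xS expr1n => /eqP; rewrite oner_eq0.
by rewrite (cone_polyE (tnormE x)) homogenizedE// -/(normalize x) px mulr0 mul0r.
Qed.

End zero_cone.

Theorem theoremE (R : realType) (d : nat) (d_gt0 : (0 < d)%N)
    (M : set (multinom d -> R[i])) (hM : closed_submodule M)
    (hp : exists2 p : mpoly d R[i], p != 0 & M (coef_of_poly p))
    (len : option nat) (phi : nat -> d.-tuple R[i] -> R[i])
    (hphi : forall n : nat, in_range len n -> multiplier (phi n))
    (hsum : strong_sum len
       (fun n : nat => mult_op (phi n) \o adjoint (mult_op (phi n)))
       (orth_proj M)) :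
  inner_sequence len phi.
Proof.
have [p p0 Mp] := hp; pose c := coef_of_poly p.
have cN m : (msize p <= mdeg m)%N -> c m = 0.
  by move=> pm; apply: memN_msupp_eq0; exact: msize_mdeg_ge.
have c0 : c <> 0.
  move=> c0; move/eqP: p0; apply; apply/mpolyP => m.
  by rewrite mcoeff0 -[LHS]/(c m) c0.
apply: filterS (surface_null cN d_gt0 c0) => z zP zS.
exact: (radial_limits_at hM hphi hsum Mp cN zS (zP zS)).
Qed.
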